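(* There is a polynomial-time algorithm that, given two configurations $C_s$ and $C_t$, each consisting of $n$ vertices of the infinite integer grid, decides whether there is a schedule with makespan $1$ transforming $C_s$ into $C_t$.
   Context: A configuration is a finite set $C$ of vertices of the infinite integer grid $\mathbb{Z}^2$ (robots are unlabeled and occupy these positions); it induces the subgraph $H$ of the grid with an edge between two positions iff they are at Euclidean distance $1$. A move $v\to w$ changes a robot's position from $v$ to a grid-adjacent position $w$, or keeps it ($w=v$). Two moves $v_1\to w_1$ and $v_2\to w_2$ are collision-free if $v_1\neq v_2$ and $w_1\neq w_2$. A transformation between configurations $C_1=\{v_1,\dots,v_n\}$ and $C_2=\{w_1,\dots,w_n\}$ is a set of pairwise collision-free moves $\{v_i\to w_i : i=1,\dots,n\}$. A schedule with makespan $M$ is a sequence $C_1\to C_2\to\cdots\to C_{M+1}$ of transformations. *)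

(* Defs.v *)
From mathcomp Require Import all_boot all_order all_algebra.
Set Implicit Arguments.
Unset Strict Implicit.
Unset Printing Implicit Defensive.
Import Order.TTheory GRing.Theory Num.Theory.

Definition point := (int * int)%type.

Definition grid_move (v w : point) : bool :=
  (v == w) || (absz (v.1 - w.1)%R + absz (v.2 - w.2)%R == 1)%N.

(* A configuration is given (as algorithm input) by a duplicate-free list
   of its positions; the configuration itself is the set [mem s].
   A transformation C1 -> C2 is a set of pairwise collision-free moves
   {v -> f v : v in C1} whose targets form C2: sources are distinct
   automatically, targets distinct = f injective on C1. *)
Definition transformation (C1 C2 : seq point) : Prop :=
  exists f : point -> point,
    [/\ {in C1 &, injective f},
        {in C1, forall v, grid_move v (f v)} &
        [seq f v | v <- C1] =i C2].

Definition schedule_makespan1 (Cs Ct : seq point) : Prop :=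
  transformation Cs Ct.

Inductive insym := S0 | S1 | Sep.

Fixpoint bits_aux (fuel n : nat) : seq insym :=
  match fuel with
  | 0 => [::]
  | fuel'.+1 =>
      if n == 0 then [::]
      else (if odd n then S1 else S0) :: bits_aux fuel' n./2
  end.
Definition bits (n : nat) : seq insym := bits_aux n n.

Definition enc_int (z : int) : seq insym :=
  (if (z < 0)%R then S1 else S0) :: bits (absz z) ++ [:: Sep].

Definition enc_point (p : point) : seq insym := enc_int p.1 ++ enc_int p.2.

Definition enc_config (s : seq point) : seq insym :=
  flatten (map enc_point s) ++ [:: Sep].

Definition enc_input (s t : seq point) : seq insym :=
  enc_config s ++ enc_config t.

Inductive move := MoveL | MoveR | Stay.

(* States are 'I_(nstates.+1); tape alphabet is 'I_(nsyms.+4), where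
   0 is the blank and 1, 2, 3 are the input symbols S0, S1, Sep.
   [tm_delta q a = None] means the machine halts. *)
Record TM := {
  tm_nstates : nat;
  tm_nsyms : nat;
  tm_start : 'I_(tm_nstates.+1);
  tm_accept : 'I_(tm_nstates.+1);
  tm_delta : 'I_(tm_nstates.+1) -> 'I_(tm_nsyms.+4) ->
             option ('I_(tm_nstates.+1) * 'I_(tm_nsyms.+4) * move) }.

Section TMsem.
Variable M : TM.
Definition tstate := 'I_((tm_nstates M).+1).
Definition tsym := 'I_((tm_nsyms M).+4).

Definition blank : tsym := @Ordinal (tm_nsyms M).+4 0 isT.
Definition sym_of (a : insym) : tsym :=
  match a with
  | S0 => @Ordinal (tm_nsyms M).+4 1 isT
  | S1 => @Ordinal (tm_nsyms M).+4 2 isT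
  | Sep => @Ordinal (tm_nsyms M).+4 3 isT
  end.

(* tape: cells left of the head (nearest first), head cell, cells right *)
Definition tape := (seq tsym * tsym * seq tsym)%type.
Definition tconf := (tstate * tape)%type.

Definition move_tape (m : move) (T : tape) : tape :=
  let: (l, a, r) := T in
  match m with
  | Stay => (l, a, r)
  | MoveL => match l with
             | [::] => ([::], blank, a :: r)
             | b :: l' => (l', b, a :: r)
             end
  | MoveR => match r with
             | [::] => (a :: l, blank, [::])
             | b :: r' => (a :: l, b, r')
             end
  end.

Definition halted (c : tconf) : bool :=
  let: (q, (_, a, _)) := c in if tm_delta q a is None then true else false.

Definition step (c : tconf) : tconf :=
  let: (q, (l, a, r)) := c in
  match tm_delta q a with
  | None => c
  | Some (q', b, m) => (q', move_tape m (l, b, r))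
  end.

Definition init_conf (w : seq insym) : tconf :=
  let w' := map sym_of w in
  (tm_start M, ([::], head blank w', behead w')).

Definition decides_within (w : seq insym) (T : nat) (P : Prop) : Prop :=
  exists t, t <= T /\
    let c := iter t step (init_conf w) in
    halted c /\ ((c.1 == tm_accept M) <-> P).
End TMsem.

(* Main.v *)
(** Making the moves pairwise collision-free with the right targets means finding a perfect
    matching in the bipartite graph joining each source to the targets at distance at
    most 1.  It is found by an auction: every target has a price, an unmatched source
    takes a cheapest adjacent target, evicts its owner and raises its price by one, and
    the auction fails once that price has reached a bound [N >= n].  The sum of the prices
    is at most [n * N], so there are polynomially many rounds.  On failure some price
    level is empty, and the owners of the targets above it violate Hall's condition.

    The prices are never computed: the targets form a list in which [N] separators are
    interspersed, the price of a target is the number of separators before it, and a bid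
    moves the first adjacent target just behind the next separator.

    The algorithm is a structured program on finitely many stacks.  On a single-tape
    machine the stacks are the tracks of the tape, with all the tops in the home cell,
    and a push or a pop is one sweep shifting a track by one cell. *)

From HB Require Import structures.
Require Import Defs.
From mathcomp Require Import all_boot all_order all_algebra.
From mathcomp Require Import zify.
From Stdlib Require Import FunctionalExtensionality.
Set Implicit Arguments.
Unset Strict Implicit.
Unset Printing Implicit Defensive.

(** * Stack programs and their simulation on one tape *)

Section StackMachine.
Variables (I S R : finType).

Definition memory := I -> seq S.
Definition upd (m : memory) (i : I) (s : seq S) : memory :=
  fun j => if j == i then s else m j.
Definition tops (m : memory) : I -> option S := fun i => ohead (m i).
Definition msize (m : memory) : nat := \sum_i size (m i).

(** Control sees only the finite register and the tops of the stacks, which is exactly what the home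
    cell shows. *)
Inductive prog :=
| Push of I & (R -> (I -> option S) -> S)
| Pop of I
| Assign of (R -> (I -> option S) -> R)
| Seq of prog & prog
| If of (R -> (I -> option S) -> bool) & prog & prog
| While of (R -> (I -> option S) -> bool) & prog.

(* The number is an upper bound on the number of elementary operations. *)
Inductive exec : prog -> R -> memory -> nat -> R -> memory -> Prop :=
| ExPush i f r m : exec (Push i f) r m 1 r (upd m i (f r (tops m) :: m i))
| ExPop i r m : exec (Pop i) r m 1 r (upd m i (behead (m i)))
| ExAssign f r m : exec (Assign f) r m 1 (f r (tops m)) m
| ExSeq p q r m n1 r1 m1 n2 r2 m2 :
    exec p r m n1 r1 m1 -> exec q r1 m1 n2 r2 m2 ->
    exec (Seq p q) r m (n1 + n2) r2 m2
| ExIf b p q r m n r' m' :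
    exec (if b r (tops m) then p else q) r m n r' m' ->
    exec (If b p q) r m n.+1 r' m'
| ExWhileT (b : R -> (I -> option S) -> bool) p r m n1 r1 m1 n2 r2 m2 :
    b r (tops m) -> exec p r m n1 r1 m1 -> exec (While b p) r1 m1 n2 r2 m2 ->
    exec (While b p) r m (n1 + n2).+1 r2 m2
| ExWhileF (b : R -> (I -> option S) -> bool) p r m : ~~ b r (tops m) -> exec (While b p) r m 1 r m
| ExWeak p r m n r' m' n' :
    exec p r m n r' m' -> n <= n' -> exec p r m n' r' m'.

(** * Compilation of a program into a finite control reading multi-track cells *)

Definition cell := {ffun I -> option S}.
Definition cblank : cell := [ffun=> None].
Definition setc (c : cell) (i : I) (x : option S) : cell :=
  [ffun j => if j == i then x else c j].

(* Labels of [Push]: [Some None] is the initial one, [Some (Some y)] moves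
   right carrying [y], [None] returns to the left.  Labels of [Pop]: [None]
   moves right, [Some x] moves left carrying [x]. *)
Fixpoint lab (p : prog) : finType :=
  match p with
  | Push _ _ | Pop _ => option (option S)
  | Assign _ => unit
  | Seq p q => (lab p + lab q)%type
  | If _ p q => option (lab p + lab q)
  | While _ p => option (lab p)
  end.

Fixpoint start (p : prog) : lab p :=
  match p with
  | Push _ _ => Some None
  | Pop _ => None
  | Assign _ => tt
  | Seq p _ => inl (start p)
  | If _ _ _ => None
  | While _ _ => None
  end.

(** Each cell of the track takes the carried symbol and hands its old one to the right. On the way
    back the head meets nonblank cells until the blank one at position -1, which locates the home
    cell. *)
Definition push_step i (f : R -> (I -> option S) -> S)
    (l : option (option S)) (r : R) (c : cell) :
    option (option (option S)) * R * cell * move :=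
  match l with
  | None => if c == cblank then (None, r, c, MoveR) else (Some None, r, c, MoveL)
  | Some o => let y := if o is Some y then y else f r c in
      (Some (omap Some (c i)), r, setc c i (Some y),
       if c i is Some _ then MoveR else MoveL)
  end.

(** The head runs to the first empty cell of the track, then shifts the track one cell towards home,
    again until the blank cell at -1. *)
Definition pop_step i (l : option (option S)) (r : R) (c : cell) :
    option (option (option S)) * R * cell * move :=
  match l with
  | None => if c i is Some _ then (Some None, r, c, MoveR)
            else (Some (Some None), r, c, MoveL)
  | Some x => if c == cblank then (None, r, c, MoveR)
              else (Some (Some (c i)), r, setc c i x, MoveL)
  end.

Fixpoint lstep (p : prog) : lab p -> R -> cell ->
    option (lab p) * R * cell * move :=
  match p return lab p -> R -> cell -> option (lab p) * R * cell * move with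
  | Push i f => push_step i f
  | Pop i => pop_step i
  | Assign f => fun _ r c => (None, f r c, c, Stay)
  | Seq p q => fun l r c =>
      match l with
      | inl l => let: (o, r', c', d) := lstep l r c in
          (Some (if o is Some l' then inl l' else inr (start q)), r', c', d)
      | inr l => let: (o, r', c', d) := lstep l r c in
          (omap inr o, r', c', d)
      end
  | If b p q => fun l r c =>
      match l with
      | None => (Some (Some (if b r c then inl (start p) else inr (start q))),
                 r, c, Stay)
      | Some (inl l) => let: (o, r', c', d) := lstep l r c in
          (omap (fun l' => Some (inl l')) o, r', c', d)
      | Some (inr l) => let: (o, r', c', d) := lstep l r c in
          (omap (fun l' => Some (inr l')) o, r', c', d)
      end
  | While b p => fun l r c =>
      match l with
      | None => (if b r c then Some (Some (start p)) else None, r, c, Stay)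
      | Some l => let: (o, r', c', d) := lstep l r c in (Some o, r', c', d)
      end
  end.

(** Defined by cases so that a move between concrete cells, such as from -1 to 0, reduces by
    computation. *)
Definition zsucc (k : int) : int :=
  match k with Posz n => Posz n.+1 | Negz 0 => Posz 0 | Negz n.+1 => Negz n end.
Definition zpred (k : int) : int :=
  match k with Posz 0 => Negz 0 | Posz n.+1 => Posz n | Negz n => Negz n.+1 end.
Definition zmove (d : move) (k : int) : int :=
  match d with MoveL => zpred k | MoveR => zsucc k | Stay => k end.

(** * Runs of the control on a two-way infinite tape *)

Definition ftape := int -> cell.
Definition fwrite (T : ftape) (k : int) (c : cell) : ftape :=
  fun j => if j == k then c else T j.

Inductive run (p : prog) : lab p -> R -> int -> ftape ->
    nat -> R -> int -> ftape -> Prop :=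
| RunExit l r k T r' c d :
    lstep l r (T k) = (None, r', c, d) ->
    run l r k T 1 r' (zmove d k) (fwrite T k c)
| RunStep l r k T l' r1 c d n r' k' T' :
    lstep l r (T k) = (Some l', r1, c, d) ->
    run l' r1 (zmove d k) (fwrite T k c) n r' k' T' ->
    run l r k T n.+1 r' k' T'.

Lemma fwrite_id T k : fwrite T k (T k) = T.
Proof.
by apply: functional_extensionality => j; rewrite /fwrite; case: eqP => // ->.
Qed.

Lemma run_exit_id p (l : lab p) r k T r' d :
  lstep l r (T k) = (None, r', T k, d) -> run l r k T 1 r' (zmove d k) T.
Proof. by move=> h; rewrite -{2}(fwrite_id T k); apply: RunExit. Qed.

Lemma run_step_id p (l l' : lab p) r r1 k T d n r' k' T' :
  lstep l r (T k) = (Some l', r1, T k, d) ->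
  run l' r1 (zmove d k) T n r' k' T' -> run l r k T n.+1 r' k' T'.
Proof.
move=> h h'; apply: (RunStep h).
by rewrite fwrite_id.
Qed.

Lemma run_seq_r p q (l : lab q) r k T n r' k' T' :
  run l r k T n r' k' T' ->
  @run (Seq p q) (inr l) r k T n r' k' T'.
Proof.
elim=> {l r k T n r' k' T'} [l r k T r' c d h|l r k T l' r1 c d n r' k' T' h _ ih].
  by apply: RunExit; rewrite /= h.
by apply: RunStep ih; rewrite /= h.
Qed.

Lemma run_seq p q (l : lab p) r k T n1 r1 k1 T1 n2 r2 k2 T2 :
  run l r k T n1 r1 k1 T1 -> run (start q) r1 k1 T1 n2 r2 k2 T2 ->
  @run (Seq p q) (inl l) r k T (n1 + n2) r2 k2 T2.
Proof.
elim=> {l r k T n1 r1 k1 T1} [l r k T r' c d h|l r k T l' r1 c d n r' k' T' h _ ih] hq.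
  apply: (@RunStep (Seq p q)) (run_seq_r p hq).
  by rewrite /= h.
rewrite addSn; apply: RunStep (ih hq).
by rewrite /= h.
Qed.

Lemma run_if_l b p q (l : lab p) r k T n r' k' T' :
  run l r k T n r' k' T' ->
  @run (If b p q) (Some (inl l)) r k T n r' k' T'.
Proof.
elim=> {l r k T n r' k' T'} [l r k T r' c d h|l r k T l' r1 c d n r' k' T' h _ ih].
  by apply: RunExit; rewrite /= h.
by apply: RunStep ih; rewrite /= h.
Qed.

Lemma run_if_r b p q (l : lab q) r k T n r' k' T' :
  run l r k T n r' k' T' ->
  @run (If b p q) (Some (inr l)) r k T n r' k' T'.
Proof.
elim=> {l r k T n r' k' T'} [l r k T r' c d h|l r k T l' r1 c d n r' k' T' h _ ih].
  by apply: RunExit; rewrite /= h.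
by apply: RunStep ih; rewrite /= h.
Qed.

Lemma run_while b p (l : lab p) r k T n1 r1 k1 T1 n2 r2 k2 T2 :
  run l r k T n1 r1 k1 T1 ->
  @run (While b p) None r1 k1 T1 n2 r2 k2 T2 ->
  @run (While b p) (Some l) r k T (n1 + n2) r2 k2 T2.
Proof.
elim=> {l r k T n1 r1 k1 T1} [l r k T r' c d h|l r k T l' r1 c d n r' k' T' h _ ih] hq.
  by apply: (@RunStep (While b p)) hq; rewrite /= h.
rewrite addSn; apply: RunStep (ih hq).
by rewrite /= h.
Qed.

(* Stack [i] is written on track [i] of the cells [0, 1, 2, ...], top first,
   so that the cell [0] shows all the tops. *)
Definition rep (m : memory) : ftape :=
  fun k => match k with
  | Posz j => [ffun i => onth (m i) j]
  | Negz _ => cblank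
  end.

Lemma rep_tops m : (rep m (Posz 0) : I -> option S) = tops m.
Proof.
apply: functional_extensionality => i.
by rewrite /tops /rep ffunE; case: (m i).
Qed.

Lemma push_left i f r (T : ftape) n :
  T (Negz 0) = cblank -> (forall j, j <= n -> T (Posz j) != cblank) ->
  @run (Push i f) None r (Posz n) T n.+2 r (Posz 0) T.
Proof.
move=> T0; elim: n => [|n IHn] hT.
  apply: (@run_step_id (Push i f) _ None _ _ _ _ MoveL).
    by rewrite /= (negbTE (hT _ _)).
  by apply: (@run_exit_id (Push i f) _ _ (Negz 0) T _ MoveR); rewrite /= T0 eqxx.
apply: (@run_step_id (Push i f) _ None _ _ _ _ MoveL).
  by rewrite /= (negbTE (hT _ _)).
by apply: IHn => j hj; apply: hT; apply: leqW.
Qed.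

Definition splice (T : ftape) (i : I) (n : nat) (s : seq S) : ftape :=
  fun k => match k with
  | Posz j => if n <= j then setc (T k) i (onth s (j - n)) else T k
  | Negz _ => T k
  end.

Lemma splice_rep m i s : splice (rep m) i 0 s = rep (upd m i s).
Proof.
apply: functional_extensionality => -[j|j] //=.
by apply/ffunP => i'; rewrite !ffunE subn0 /upd; case: eqP.
Qed.

Lemma onth_none (s : seq S) j : size s <= j -> onth s j = None.
Proof. by elim: s j => [|x s IHs] [|j] //=; apply: IHs. Qed.

Lemma onth_some (s : seq S) j : j < size s -> exists x, onth s j = Some x.
Proof. by elim: s j => [|x s IHs] [|j] //= hj; [exists x | apply: IHs]. Qed.

(** Induction on the part [s] of the track from cell [n] on; [o] carries the symbol displaced last,
    or is [None] when the new top is still to be computed. *)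
Lemma push_right i (f : R -> (I -> option S) -> S) r o y (s : seq S) (T : ftape) n :
  (forall j, (T (Posz (n + j))) i = onth s j) ->
  y = (if o is Some y' then y' else f r (T (Posz n))) ->
  T (Negz 0) = cblank -> (forall j, j < n -> T (Posz j) != cblank) ->
  @run (Push i f) (Some o) r (Posz n) T ((size s).*2 + n).+2 r (Posz 0)
    (splice T i n (y :: s)).
Proof.
elim: s o y T n => [|x s IHs] o y T n hs hy T0 hT.
- have e : splice T i n [:: y] = fwrite T (Posz n) (setc (T (Posz n)) i (Some y)).
    apply: functional_extensionality => -[j|j] //=; rewrite /fwrite eqz_nat.
    case: ltngtP => hj //.
      apply/ffunP => i'; rewrite !ffunE; case: eqP => // ->.
      by rewrite -{2}(subnKC (ltnW hj)) hs !onth_none ?subn_gt0.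
    by rewrite hj subnn.
  have hn : (T (Posz n)) i = None by rewrite -[n]addn0 hs.
  have h0 : splice T i n [:: y] (Negz 0) = cblank by [].
  have h1 j : j <= n -> splice T i n [:: y] (Posz j) != cblank.
    rewrite /=; case: ltngtP => // hj _; first exact: hT.
    by apply/eqP => /ffunP /(_ i); rewrite !ffunE eqxx hj subnn.
  case: n => [|n] in hs hy hT e hn h0 h1 *.
    apply: (@RunStep (Push i f) _ _ _ _ None r (setc (T (Posz 0)) i (Some y)) MoveL).
      by rewrite /= hn -hy.
    rewrite -e; apply: (@run_exit_id (Push i f) _ _ (Negz 0) _ _ MoveR).
    by rewrite /= T0 eqxx.
  apply: (@RunStep (Push i f) _ _ _ _ None r (setc (T (Posz n.+1)) i (Some y)) MoveL).
    by rewrite /= hn -hy.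
  rewrite -e; apply: push_left => // j hj; apply: h1; exact: leqW.
have hn : (T (Posz n)) i = Some x by rewrite -[n]addn0 hs.
pose T1 := fwrite T (Posz n) (setc (T (Posz n)) i (Some y)).
have e : splice T i n (y :: x :: s) = splice T1 i n.+1 (x :: s).
  apply: functional_extensionality => -[j|j] //=; rewrite /T1 /fwrite eqz_nat.
  case: ltngtP => // [hj|hj]; last by rewrite hj subnn.
  by rewrite subnS; case: (j - n) (subn_gt0 n j) => //; rewrite hj.
rewrite e /= doubleS.
apply: (@RunStep (Push i f) _ _ _ _ (Some (Some x)) r (setc (T (Posz n)) i (Some y)) MoveR).
  by rewrite /= hn -hy.
rewrite addSnnS.
apply: IHs => // [j|j hj]; rewrite /T1 /fwrite eqz_nat.
  by rewrite addSn eqn_leq leqNgt ltnS leq_addr /= -addnS hs.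
case: (j =P n) => hjn; last by apply: hT; rewrite ltn_neqAle -ltnS hj andbT; apply/eqP.
by apply/eqP => /ffunP /(_ i); rewrite !ffunE eqxx.
Qed.

Lemma run_push i f r m :
  run (start (Push i f)) r (Posz 0) (rep m) ((size (m i)).*2).+2 r (Posz 0)
    (rep (upd m i (f r (tops m) :: m i))).
Proof.
rewrite -splice_rep -[_.*2]addn0; apply: push_right => // [j|].
  by rewrite /= ffunE.
by rewrite rep_tops.
Qed.

Lemma pop_left i r (T : ftape) x n :
  T (Negz 0) = cblank -> (forall j, j <= n -> T (Posz j) != cblank) ->
  @run (Pop i) (Some x) r (Posz n) T n.+2 r (Posz 0)
    (fun k => match k with
      | Posz j => if j <= n then
          setc (T k) i (if j == n then x else (T (Posz j.+1)) i) else T k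
      | Negz _ => T k end).
Proof.
move=> T0; elim: n x T T0 => [|n IHn] x T T0 hT.
  apply: (@RunStep (Pop i) _ _ _ _ (Some ((T (Posz 0)) i)) r (setc (T (Posz 0)) i x) MoveL).
    by rewrite /= (negbTE (hT _ _)).
  rewrite /=; set T1 := fwrite _ _ _.
  have <- : T1 = (fun k : int => match k with
      | Posz j => if j <= 0 then
          setc (T k) i (if j == 0 then x else (T (Posz j.+1)) i) else T k
      | Negz _ => T k end).
    by apply: functional_extensionality => -[[|j]|j].
  by apply: (@run_exit_id (Pop i) _ _ (Negz 0) _ _ MoveR); rewrite /= /T1 /fwrite /= T0 eqxx.
apply: (@RunStep (Pop i) _ _ _ _ (Some ((T (Posz n.+1)) i)) r (setc (T (Posz n.+1)) i x) MoveL).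
  by rewrite /= (negbTE (hT _ _)).
have -> : (fun k : int => match k with
      | Posz j => if j <= n.+1 then
          setc (T k) i (if j == n.+1 then x else (T (Posz j.+1)) i) else T k
      | Negz _ => T k end) =
   (fun k => match k with
      | Posz j => if j <= n then
          setc (fwrite T (Posz n.+1) (setc (T (Posz n.+1)) i x) k) i
            (if j == n then (T (Posz n.+1)) i else
               (fwrite T (Posz n.+1) (setc (T (Posz n.+1)) i x) (Posz j.+1)) i)
          else fwrite T (Posz n.+1) (setc (T (Posz n.+1)) i x) k
      | Negz _ => fwrite T (Posz n.+1) (setc (T (Posz n.+1)) i x) k end).
  apply: functional_extensionality => -[j|j] //.
  rewrite /fwrite !eqz_nat eqSS.
  case: (ltngtP j n) => [h|h|->].
  - by rewrite (ltn_eqF (leqW h)) leqW // ltnW.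
  - by case: (ltngtP j n.+1) => [h1|//|->//]; rewrite ltnS leqNgt h in h1.
  - by rewrite leqnSn (ltn_eqF (ltnSn n)).
apply: IHn => // j hj; rewrite /fwrite eqz_nat; case: (j =P n.+1) => [e|_].
  by rewrite e ltnn in hj.
by apply: hT; apply: leqW.
Qed.

Lemma pop_right i r (T : ftape) s n N T' :
  (forall j, (T (Posz (n + j))) i = onth s j) ->
  @run (Pop i) (Some None) r (zpred (Posz (n + size s))) T N r (Posz 0) T' ->
  @run (Pop i) None r (Posz n) T ((size s).+1 + N) r (Posz 0) T'.
Proof.
elim: s n => [|x s IHs] n hs h.
  rewrite addn0 in h; apply: (@run_step_id (Pop i) None (Some None) r r (Posz n) T MoveL) h.
  by rewrite /= -[n]addn0 hs.
rewrite addSn; apply: (@run_step_id (Pop i) _ None _ _ _ _ MoveR).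
  by rewrite /= -[n]addn0 hs.
apply: IHs => [j|]; first by rewrite addSnnS hs.
by rewrite addSnnS.
Qed.

Lemma run_pop i r m :
  run (start (Pop i)) r (Posz 0) (rep m) ((size (m i)).*2).+2 r (Posz 0)
    (rep (upd m i (behead (m i)))).
Proof.
(* One sweep to the right and one back, of equal length. *)
have -> : (size (m i)).*2.+2 = (size (m i)).+1 + (size (m i)).+1.
  by rewrite addnS addSn addnn.
apply: (@pop_right _ _ _ (m i)) => [j|]; first by rewrite /= ffunE.
rewrite add0n; case e : (m i) => [|x s] /=.
  have -> : upd m i [::] = m.
    by apply: functional_extensionality => j; rewrite /upd; case: eqP => // ->.
  by apply: (@run_exit_id (Pop i) _ _ (Negz 0) _ _ MoveR); rewrite /= eqxx.
have -> : rep (upd m i s) = (fun k => match k with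
      | Posz j => if j <= size s then
          setc (rep m k) i (if j == size s then None else (rep m (Posz j.+1)) i)
           else rep m k
      | Negz _ => rep m k end).
  apply: functional_extensionality => -[j|j] //.
  apply/ffunP => i'; rewrite /rep !ffunE /upd.
  case: (ltngtP j (size s)) => [h|h|h]; rewrite !ffunE; case: (i' =P i) => // ei; rewrite ?ei.
  - by rewrite e.
  - by rewrite e !onth_none //= ltnW.
  - by rewrite h onth_none.
apply: pop_left => // j hj; rewrite /rep.
have [y hy] : exists y, onth (m i) j = Some y by apply: onth_some; rewrite e.
by apply/eqP => /ffunP /(_ i); rewrite !ffunE hy.
Qed.

Lemma msize_upd m i s k : size s <= size (m i) + k ->
  msize (upd m i s) <= msize m + k.
Proof.
move=> h; rewrite /msize (bigD1 i) //= [in leqRHS](bigD1 i) //= /upd eqxx.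
rewrite addnAC leq_add //.
by apply: eq_leq; apply: eq_bigr => j /negbTE ->.
Qed.

Lemma size_msize m i : size (m i) <= msize m.
Proof. by rewrite /msize (bigD1 i) //= leq_addr. Qed.

(** An operation adds at most one symbol, so the stacks never hold more than the initial size plus
    the number of operations, and this bounds every sweep. The common bound [K] is quantified so
    that all parts of a program can share it. *)
Lemma exec_run p r m n r' m' : exec p r m n r' m' ->
  msize m' <= msize m + n /\
  forall K, msize m + n <= K -> exists2 t, t <= n * (K.*2 + 3) &
    run (start p) r (Posz 0) (rep m) t r' (Posz 0) (rep m').
Proof.
elim=> {p r m n r' m'}.
- move=> i f r m; split; first by apply: msize_upd; rewrite addn1.
  move=> K hK; have := size_msize m i => h.
  by eexists; last exact: run_push; lia.
- move=> i r m; split; first by apply: msize_upd; rewrite size_behead; lia.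
  move=> K hK; have := size_msize m i => h.
  by eexists; last exact: run_pop; lia.
- move=> f r m; split; first by rewrite leq_addr.
  move=> K hK; exists 1; first lia.
  by apply: (@run_exit_id (Assign f) _ _ (Posz 0) _ _ Stay); rewrite /= -rep_tops.
- move=> p q r m n1 r1 m1 n2 r2 m2 _ [s1 IH1] _ [s2 IH2]; split; first lia.
  move=> K hK; have [|t1 h1 e1] := IH1 K; first lia.
  have [|t2 h2 e2] := IH2 K; first lia.
  exists (t1 + t2); first by rewrite mulnDl leq_add.
  exact: run_seq e1 e2.
- move=> b p q r m n r' m' _ [s IH]; split; first lia.
  move=> K hK; have [|t h e] := IH K; first lia.
  exists t.+1; first lia.
  apply: (@run_step_id (If b p q) _ _ _ _ (Posz 0) _ Stay).
    by rewrite /= rep_tops.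
  by case: (b r (tops m)) in e *; [apply: run_if_l | apply: run_if_r].
- move=> b p r m n1 r1 m1 n2 r2 m2 hb _ [s1 IH1] _ [s2 IH2]; split; first lia.
  move=> K hK; have [|t1 h1 e1] := IH1 K; first lia.
  have [|t2 h2 e2] := IH2 K; first lia.
  exists (t1 + t2).+1; first by rewrite mulSn mulnDl; lia.
  apply: (@run_step_id (While b p) _ _ _ _ (Posz 0) _ Stay).
    by rewrite /= rep_tops hb.
  exact: run_while e1 e2.
- move=> b p r m hb; split; first lia.
  move=> K hK; exists 1; first lia.
  by apply: (@run_exit_id (While b p) _ _ (Posz 0) _ _ Stay); rewrite /= rep_tops (negbTE hb).
- move=> p r m n r' m' n' _ [s IH] hn; split; first lia.
  move=> K hK; have [|t h e] := IH K; first lia.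
  exists t => //; apply: leq_trans h _; exact: leq_mul.
Qed.

End StackMachine.

(** * The Turing machine of a stack program *)

Lemma zsuccK : cancel zsucc zpred.
Proof. by case=> [n|[|n]]. Qed.

Lemma zpredK : cancel zpred zsucc.
Proof. by case=> [[|n]|n]. Qed.

Lemma zsuccE k : zsucc k = (k + 1)%R.
Proof. by case: k => [n|[|n]] /=; lia. Qed.

Lemma iter_zsucc j k : iter j zsucc k = (k + j%:Z)%R.
Proof. by elim: j => [|j IHj] /=; [lia | rewrite IHj zsuccE; lia]. Qed.

Lemma iter_zpred j k : iter j zpred k = (k - j%:Z)%R.
Proof.
elim: j => [|j IHj] /=; first lia.
by apply: (can_inj zsuccK); rewrite zpredK IHj zsuccE; lia.
Qed.

Section Compile.
Variables (I S R : finType) (i0 : I) (emb : insym -> S) (racc : R) (p : prog I S R).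

Notation state := (option (lab p) * R)%type.
Notation cell := (cell I S).

Definition input_cell (a : insym) : cell :=
  [ffun i => if i == i0 then Some (emb a) else None].

(** The tape alphabet reserves the indices 0 to 3 for the blank and the input symbols, so their
    cells come first. They occur again in the enumeration, but [index] returns the first
    occurrence. *)
Definition codes : seq cell :=
  [:: cblank I S; input_cell S0; input_cell S1; input_cell Sep] ++ enum {: cell}.
Definition decode_cell (a : 'I_(#|{: cell}|.+4)) : cell := nth (cblank I S) codes a.
Definition encode_cell (c : cell) : 'I_(#|{: cell}|.+4) := inord (index c codes).

Lemma encode_cellK : cancel encode_cell decode_cell.
Proof.
move=> c; have hc : c \in codes by rewrite mem_cat mem_enum orbT.
rewrite /decode_cell /encode_cell inordK ?nth_index //.
by rewrite -[X in _ < X](_ : size codes = _) ?index_mem // size_cat -cardE.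
Qed.

Definition encode_state (q : state) : 'I_(#|{: state}|.+1) := inord (index q (enum {: state})).
Definition decode_state (s : 'I_(#|{: state}|.+1)) : state := nth (None, racc) (enum {: state}) s.

Lemma encode_stateK : cancel encode_state decode_state.
Proof.
move=> q; have hq : q \in enum {: state} by rewrite mem_enum.
rewrite /decode_state /encode_state inordK ?nth_index //.
by rewrite ltnS cardE ltnW // index_mem.
Qed.

(** The label [None] halts the machine, and acceptance is the single halting state whose register is
    [racc]. *)
Definition machine (r0 : R) : TM := {|
  tm_nstates := #|{: state}|;
  tm_nsyms := #|{: cell}|;
  tm_start := encode_state (Some (start p), r0);
  tm_accept := encode_state (None, racc);
  tm_delta := fun s a =>
    let: (o, r) := decode_state s in
    if o is Some l then
      let: (o', r', c, d) := lstep l r (decode_cell a) in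
      Some (encode_state (o', r'), encode_cell c, d)
    else None |}.

Variable r0 : R.
Notation M := (machine r0).

(** With the blank as default of [nth], the finite lists become the two half-infinite tapes seen
    from the head at [k]. *)
Definition tape_sim (t : tape M) (k : int) (T : ftape I S) : Prop :=
  let: (l, a, r) := t in
  (forall j, decode_cell (nth (blank M) (a :: r) j) = T (iter j zsucc k)) /\
  (forall j, decode_cell (nth (blank M) l j) = T (iter j.+1 zpred k)).

Lemma decode_blank : decode_cell (blank M) = cblank I S.
Proof. by []. Qed.

Lemma tape_sim_write l a r k T c : tape_sim (l, a, r) k T ->
  tape_sim (l, encode_cell c, r) k (fwrite T k c).
Proof.
move=> [h1 h2]; split=> j.
  case: j => [|j]; first by rewrite /= encode_cellK /fwrite eqxx.
  rewrite (h1 j.+1) /fwrite iter_zsucc.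
  by have -> : (k + j.+1 == k :> int)%R = false by lia.
rewrite h2 /fwrite iter_zpred.
by have -> : (k - j.+1%:Z == k :> int)%R = false by lia.
Qed.

Lemma tape_sim_move t k T d : tape_sim t k T ->
  tape_sim (move_tape d t) (zmove d k) T.
Proof.
case: t => [[l a] r] [h1 h2]; case: d => //.
  have e j : decode_cell (nth (blank M) (behead l) j) = T (iter j.+1 zpred (zpred k)).
    by rewrite nth_behead h2 -iterSr.
  have e' j : decode_cell (nth (blank M) (head (blank M) l :: a :: r) j) = T (iter j zsucc (zpred k)).
    case: j => [|j]; first by rewrite nth0 /= -nth0 h2.
    by rewrite [LHS](h1 j) iterSr zpredK.
  by case: l h2 e e' => [|b l] _ e e'; split=> // j; rewrite -e.
have e j : decode_cell (nth (blank M) (a :: l) j) = T (iter j.+1 zpred (zsucc k)).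
  rewrite iterSr zsuccK; case: j => [|j]; first exact: (h1 0).
  by rewrite [LHS]h2.
have e' j : decode_cell (nth (blank M) r j) = T (iter j zsucc (zsucc k)).
  by rewrite -iterSr -(h1 j.+1).
case: r h1 e' => [|b r] _ e'; split=> // j.
by rewrite -e'; case: j => [|j] //=; rewrite nth_nil.
Qed.

Definition conf_sim (c : tconf M) (q : state) (k : int) (T : ftape I S) : Prop :=
  c.1 = encode_state q /\ tape_sim c.2 k T.

Lemma step_sim c l r k T o r' b d :
  lstep l r (T k) = (o, r', b, d) -> conf_sim c (Some l, r) k T ->
  conf_sim (step c) (o, r') (zmove d k) (fwrite T k b).
Proof.
case: c => q [[tl a] tr] h [/= -> ht].
have ha : decode_cell a = T k by case: ht => h1 _; exact: (h1 0).
rewrite /step /= encode_stateK ha h; split=> //=.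
exact: (@tape_sim_move (_, _, _) _ _ _ (tape_sim_write _ ht)).
Qed.

Lemma run_sim l r k T n r' k' T' : @run I S R p l r k T n r' k' T' ->
  forall c, conf_sim c (Some l, r) k T ->
  conf_sim (iter n (@step M) c) (None, r') k' T'.
Proof.
elim=> {l r k T n r' k' T'} [l r k T r' b d h|l r k T l' r1 b d n r' k' T' h _ ih] c hc.
  exact: step_sim h hc.
by rewrite iterSr; apply: ih; apply: step_sim h hc.
Qed.

Definition input_mem (w : seq insym) : memory I S :=
  upd (fun _ => [::]) i0 (map emb w).

Lemma init_sim w :
  conf_sim (init_conf M w) (Some (start p), r0) (Posz 0) (rep (input_mem w)).
Proof.
split=> //; split=> j; last first.
  by rewrite iter_zpred nth_nil decode_blank; case e : (0 - j.+1%:Z)%R => //; lia.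
rewrite iter_zsucc GRing.add0r /=.
have -> : nth (blank M) (head (blank M) [seq sym_of M a | a <- w]
    :: behead [seq sym_of M a | a <- w]) j = nth (blank M) [seq sym_of M a | a <- w] j.
  by case: w => [|a w] //; case: j => [|j] //=; rewrite nth_nil.
apply/ffunP => i; rewrite !ffunE /input_mem /upd.
elim: w j => [|a w IHw] [|j] /=; try by rewrite ffunE; case: eqP.
  by case: a; rewrite /= !ffunE; case: eqP.
by rewrite IHw; case: eqP => _ //; rewrite onth_none.
Qed.

Theorem exec_decides w n r' m' :
  exec p r0 (input_mem w) n r' m' ->
  decides_within M w (n * ((size w + n).*2 + 3)) (r' = racc).
Proof.
move=> /exec_run [_ hK].
have hs : msize (input_mem w) = size w.
  rewrite /msize (bigD1 i0) //= /input_mem /upd eqxx size_map big1 ?addn0 //.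
  by move=> i /negbTE ->.
have [t ht hr] := hK (size w + n) (eq_leq (congr1 (addn^~ n) hs)).
exists t; split=> //=.
have := run_sim hr (init_sim w).
case: (iter _ _ _) => q [[l a] r] [/= -> _]; rewrite encode_stateK; split=> //.
rewrite (can_eq encode_stateK) xpair_eqE eqxx /=.
by split=> [/eqP|->].
Qed.

End Compile.

(** * The auction *)

(* [Some (t, o)] is a target with its current owner, [None] is a separator;
   the price of a target is the number of separators in front of it. *)
Definition item := option (point * option point).

Definition is_sep (x : item) : bool := x == None.
Definition nsep (A : seq item) : nat := count is_sep A.
Definition adjacent (s : point) (x : item) : bool :=
  if x is Some (t, _) then grid_move s t else false.

Definition priced := (nat * (point * option point))%type.

Fixpoint recs (k : nat) (A : seq item) : seq priced :=
  match A with
  | [::] => [::]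
  | None :: A' => recs k.+1 A'
  | Some x :: A' => (k, x) :: recs k A'
  end.

Lemma recs_cat k A B : recs k (A ++ B) = recs k A ++ recs (k + nsep A) B.
Proof.
elim: A k => [|[x|] A IHA] k /=; first by rewrite addn0.
  by rewrite IHA.
by rewrite IHA /nsep /= addnA addn1.
Qed.

Lemma recs_bounds k A x : x \in recs k A -> k <= x.1 <= k + nsep A.
Proof.
elim: A k => [|[y|] A IHA] k //=.
  rewrite in_cons => /orP [/eqP -> /=|/IHA //]; rewrite leqnn leq_addr //.
by move/IHA; rewrite /nsep /=; lia.
Qed.

Lemma mem_recs k A x : x \in recs k A -> Some x.2 \in A.
Proof.
elim: A k => [|[y|] A IHA] k //=.
  by rewrite !in_cons => /orP [/eqP -> /=|/IHA ->]; rewrite ?eqxx ?orbT.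
by move/IHA; rewrite in_cons orbC => ->.
Qed.

(** The source [s] cannot bid: its first, hence cheapest, adjacent target has no separator behind it
    and so already costs [nsep A], or there is no such target. *)
Definition stuck (s : point) (A : seq item) : Prop :=
  (exists P t o Q, [/\ A = P ++ Some (t, o) :: Q, ~~ has (adjacent s) P,
     grid_move s t & ~~ has is_sep Q]) \/ ~~ has (adjacent s) A.

Variant choice_spec (s : point) (A : seq item) : Prop :=
| Stuck of stuck s A
| Bid P t o Q1 Q2 of A = P ++ Some (t, o) :: Q1 ++ None :: Q2
    & ~~ has (adjacent s) P & grid_move s t & ~~ has is_sep Q1.

Lemma choiceP s A : choice_spec s A.
Proof.
case: (boolP (has (adjacent s) A)) => [h|]; last by move=> h; apply: Stuck; right.
case/split_find: h => -[[t o]|] // P Q hx hP.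
case: (boolP (has is_sep Q)) => hQ; last first.
  by apply: Stuck; left; exists P, t, o, Q; rewrite cat_rcons.
case/split_find: hQ => y Q1 Q2 /eqP -> hQ1.
by apply: (@Bid s _ P t o Q1 Q2); rewrite ?cat_rcons.
Qed.

Section Auction.
Variables Cs Ct : seq point.

Definition target (x : priced) : point := x.2.1.
Definition owner (x : priced) : option point := x.2.2.

(* The last condition is the complementary slackness of the auction: an owner
   pays at most one more than the cheapest of its adjacent targets. *)
Definition auction_inv (U : seq point) (L : seq priced) : Prop :=
  [/\ perm_eq (map target L) Ct,
      perm_eq (pmap owner L ++ U) Cs,
      {in L, forall x s, owner x = Some s -> grid_move s (target x)},
      {in L, forall x, owner x = None -> x.1 = 0} &
      {in L &, forall x y s, owner x = Some s -> grid_move s (target y) ->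
         x.1 <= y.1.+1}].

Lemma auction_inv_perm U L L' :
  perm_eq L L' -> auction_inv U L -> auction_inv U L'.
Proof.
move=> pL [h1 h2 h3 h4 h5]; have mL := perm_mem pL; split.
- by rewrite -(permPl (perm_map target pL)).
- by apply: perm_trans h2; rewrite perm_cat2r perm_pmap // perm_sym.
- by move=> x; rewrite -mL; apply: h3.
- by move=> x; rewrite -mL; apply: h4.
- by move=> x y; rewrite -!mL; apply: h5.
Qed.

(** Slackness survives: [s] pays one more than [k], the least price it sees, and for the other
    owners a raised price only relaxes the bound. *)
Lemma auction_inv_bid s U k t o L :
  auction_inv (s :: U) ((k, (t, o)) :: L) -> grid_move s t ->
  {in L, forall y, grid_move s (target y) -> k <= y.1} ->
  auction_inv (seq_of_opt o ++ U) ((k.+1, (t, Some s)) :: L).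
Proof.
move=> [h1 h2 h3 h4 h5] hst hmin; split=> //.
- apply: perm_trans h2; rewrite /=.
  have -> : oapp (cons^~ (pmap owner L)) (pmap owner L) (owner (k, (t, o))) =
    seq_of_opt o ++ pmap owner L by case: o {h1 h3 h4 h5}.
  by apply/permP => P; rewrite /= !count_cat /=; lia.
- move=> x; rewrite in_cons => /orP [/eqP -> s' [<-] //|hx].
  by apply: h3; rewrite in_cons hx orbT.
- move=> x; rewrite in_cons => /orP [/eqP -> //|hx].
  by apply: h4; rewrite in_cons hx orbT.
move=> x y; rewrite !in_cons.
case/orP=> [/eqP ->|hx] /orP [/eqP ->|hy] s'.
- by move=> _ _; rewrite leqnSn.
- by move=> [<-] hs; rewrite ltnS; apply: hmin.
- move=> hs hm; apply: leqW.
  apply: (h5 x (k, (t, o)) _ _ s' hs hm); first by rewrite in_cons hx orbT.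
  exact: mem_head.
- by apply: h5; rewrite in_cons ?hx ?hy orbT.
Qed.

Hypotheses (uCs : uniq Cs) (uCt : uniq Ct) (eqs : size Cs = size Ct).

(** With no source left unmatched, ownership matches all of [Cs]; the equal sizes make its image all
    of [Ct]. *)
Lemma auction_accept L : auction_inv [::] L -> transformation Cs Ct.
Proof.
move=> [h1 h2 h3 _ _]; rewrite cats0 in h2.
pose x0 : priced := (0, ((0, 0)%R, None)).
pose w v := nth x0 L (find (fun x => owner x == Some v) L).
have hw v : v \in Cs -> w v \in L /\ owner (w v) = Some v.
  rewrite -(perm_mem h2) mem_pmap => /mapP [x hx e].
  have h : has (fun x => owner x == Some v) L by apply/hasP; exists x; rewrite // -e.
  split; first by rewrite mem_nth // -has_find.
  by apply/eqP; apply: (nth_find x0 h).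
have ut : uniq (map target L) by rewrite (perm_uniq h1).
(* Targets are listed without repetition, so a record is determined by its target. *)
have inj : {in Cs &, injective (fun v => target (w v))}.
  move=> v v' /hw [hv ov] /hw [hv' ov'] e.
  suff : w v = w v' by move=> e'; move: ov'; rewrite -e' ov => -[].
  rewrite -(nth_index x0 hv) -(nth_index x0 hv'); congr nth.
  apply/eqP; rewrite -(nth_uniq (target x0) _ _ ut) ?size_map ?index_mem //.
  by rewrite !(nth_map x0) ?index_mem // !nth_index // e.
exists (fun v => target (w v)); split=> //.
  by move=> v /hw [hv ov]; apply: h3.
have sub : {subset [seq target (w v) | v <- Cs] <= Ct}.
  move=> _ /mapP [v /hw [hv _] ->].
  by rewrite -(perm_mem h1) map_f.
have u : uniq [seq target (w v) | v <- Cs] by rewrite map_inj_in_uniq.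
by have [] := uniq_min_size u sub _; rewrite ?size_map ?eqs.
Qed.

(* Some price level [l] in [1, N] is empty, because there are more levels than
   owned targets.  The owners of the targets above [l], together with [s],
   only see targets above [l]: this violates Hall's condition. *)
Lemma auction_reject s U L N : auction_inv (s :: U) L -> size Ct <= N ->
  {in L, forall y, grid_move s (target y) -> N <= y.1} ->
  ~ transformation Cs Ct.
Proof.
move=> [h1 h2 h3 h4 h5] hN hs [f [finj fadj fim]].
have hsz : size (pmap owner L) < N.
  by have := perm_size h2; rewrite size_cat /= => e; rewrite -eqs -e in hN; apply: leq_trans hN; rewrite addnS ltnS leq_addr.
have [l] : exists l, [/\ 0 < l, l <= N & l \notin map fst L].
  case: (boolP (all (mem (map fst L)) (iota 1 N))) => [h|/allPn [l]]; last first.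
    by rewrite mem_iota add1n ltnS => /andP [? ?] ?; exists l.
  (* Were all levels from 1 to [N] occupied, each would hold an owned target, since unowned ones
     cost 0. *)
  suff : N <= size (pmap owner L) by rewrite leqNgt hsz.
  rewrite -[N in N <= _](size_iota 1 N) size_pmap -[count _ _]size_filter.
  rewrite -(size_map fst); apply: uniq_leq_size (iota_uniq _ _) _ => k hk.
  have /mapP [x hx e] := allP h _ hk.
  rewrite e map_f // mem_filter hx andbT.
  case eo : (owner x) => //=; have := h4 _ hx eo; move: hk.
  by rewrite mem_iota e; lia.
move=> [l0 lN hl].
have above x : x \in L -> l <= x.1 -> l < x.1.
  move=> hx hlx; rewrite ltn_neqAle hlx andbT.
  by apply: contraNneq hl => ->; apply: map_f.
pose B := [seq x <- L | l < x.1].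
pose W := s :: pmap owner B.
have sub : {subset W <= Cs}.
  move=> v; rewrite -(perm_mem h2) mem_cat in_cons => /orP [/eqP ->|].
    by rewrite mem_head orbT.
  rewrite !mem_pmap => /mapP [x hx ->].
  by rewrite map_f //; move: hx; rewrite mem_filter => /andP [].
have uW : uniq W.
  have : uniq (pmap owner L ++ s :: U) by rewrite (perm_uniq h2).
  rewrite cat_uniq /= negb_or => /and3P [uL /andP [sL _] _].
  have ss : subseq (pmap owner B) (pmap owner L).
    rewrite /B; elim: (L) => //= x M IH; case: ifP => _ /=; case: (owner x) => //= v.
      by rewrite eqxx.
    exact: subseq_trans IH (subseq_cons _ _).
  by rewrite /= (subseq_uniq ss uL) andbT; apply: contra sL; apply: mem_subseq.
have im : {subset map f W <= map target B}.
  move=> _ /mapP [v hv ->].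
  have : f v \in Ct by rewrite -fim map_f // sub.
  rewrite -(perm_mem h1) => /mapP [y hy ey].
  have hvy : grid_move v (target y) by rewrite -ey fadj ?sub.
  (* It suffices to reach level [l], which is empty: [s] sees only prices from [N] on, and slackness
     handles the owners above [l]. *)
  rewrite ey map_f // mem_filter hy andbT; apply: above => //.
  move: hv; rewrite in_cons => /orP [/eqP e|].
    by rewrite e in hvy; apply: leq_trans lN (hs _ hy hvy).
  rewrite mem_pmap => /mapP [x]; rewrite mem_filter => /andP [hlx hx] eo.
  by rewrite -ltnS; apply: leq_trans hlx (h5 _ _ hx hy _ (esym eo) hvy).
have uf : uniq (map f W).
  by rewrite map_inj_in_uniq // => v v' hv hv'; apply: finj; apply: sub.
(* All targets of [B] are owned, their prices being positive, so [W] has one element more than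
   [B]. *)
have := uniq_leq_size uf im; rewrite !size_map /= size_pmap.
have -> : count owner B = size B; last by rewrite ltnn.
apply/eqP; rewrite -all_count; apply/allP => x.
rewrite mem_filter => /andP [hlx hx]; case eo : (owner x) => //.
by move: hlx; rewrite (h4 _ hx eo).
Qed.

End Auction.

(** * Moving words between stacks *)

(* [SU]: unmatched sources; [SA]: items still to scan; [SB]: scanned items,
   mirrored; [SX]: current source; [SY], [SH]: scratch. *)
Inductive stk := SU | SA | SB | SX | SY | SH.

Definition stk_code (i : stk) : 'I_6 :=
  match i with
  | SU => @Ordinal 6 0 isT | SA => @Ordinal 6 1 isT | SB => @Ordinal 6 2 isT
  | SX => @Ordinal 6 3 isT | SY => @Ordinal 6 4 isT | SH => @Ordinal 6 5 isT
  end.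
Definition stk_decode (k : 'I_6) : stk :=
  match val k with 0 => SU | 1 => SA | 2 => SB | 3 => SX | 4 => SY | _ => SH end.
Lemma stk_codeK : cancel stk_code stk_decode.
Proof. by case. Qed.
HB.instance Definition _ := Countable.copy stk (can_type stk_codeK).
HB.instance Definition _ : isFinite stk := CanIsFinite stk_codeK.

(** The letters are the binary digits, the separator of the input, and the price separator [Gp],
    which occurs in no encoded input. *)
Definition sym : finType := option (option bool).
Notation Dg b := (Some (Some b) : sym).
Notation Sp := (Some None : sym).
Notation Gp := (None : sym).

Definition emb (a : insym) : sym :=
  match a with S0 => Dg false | S1 => Dg true | Sep => Sp end.

Definition tri := ('I_3 * 'I_3 * 'I_3)%type.
(* State of the adjacency test (see [slot]), signs of the two numbers being
   compared, and whether the auction has not failed yet. *)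
Definition reg : finType := (tri * (bool * bool) * bool)%type.

Notation stacks := (memory stk sym).
Notation program := (prog stk sym reg).

Section Moves.
Implicit Types (r : reg) (m : stacks) (i j : stk) (s w : seq sym).

Lemma exec_conv (p : program) r m n r' m' n' m'' :
  exec p r m n r' m' -> n <= n' -> m' = m'' -> exec p r m n' r' m''.
Proof. by move=> h hn <-; apply: ExWeak h hn. Qed.

Definition nop : program := Assign (fun r _ => r).

Definition mv i j : program :=
  Seq (Push j (fun _ c => odflt Sp (c i))) (Pop _ _ i).

Definition on_top (P : pred sym) i : reg -> (stk -> option sym) -> bool :=
  fun _ c => if c i is Some x then P x else false.

Definition mvw (P : pred sym) i j : program := While (on_top P i) (mv i j).

Lemma upd_upd m i s s' : upd (upd m i s) i s' = upd m i s'.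
Proof.
by apply: functional_extensionality => k; rewrite /upd; case: eqP.
Qed.

Lemma updC m i j s s' : i != j -> upd (upd m i s) j s' = upd (upd m j s') i s.
Proof.
move=> ij; apply: functional_extensionality => k; rewrite /upd.
by case: eqP => // ->; rewrite eq_sym (negbTE ij).
Qed.

Lemma upd_eq m i s : upd m i s i = s.
Proof. by rewrite /upd eqxx. Qed.

Lemma upd_neq m i j s : i != j -> upd m i s j = m j.
Proof. by rewrite /upd eq_sym => /negbTE ->. Qed.

Definition moved m i j w s : stacks := upd (upd m j (rev w ++ m j)) i s.

Lemma moved_src m i j w s : moved m i j w s i = s.
Proof. exact: upd_eq. Qed.

Lemma moved_cat m i j w w' s s' : i != j ->
  moved (moved m i j w s) i j w' s' = moved m i j (w ++ w') s'.
Proof.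
move=> ij; rewrite /moved (upd_neq _ _ ij) upd_eq (updC _ _ _ ij) upd_upd.
by rewrite upd_upd rev_cat catA.
Qed.

(** The rest [s] of the source stack is arbitrary, so moves compose. The word arrives reversed; a
    second move restores it. *)
Definition moves (p : program) i j w n : Prop :=
  forall r m s, i != j -> m i = w ++ s -> exec p r m n r (moved m i j w s).

Lemma moves_seq p q i j w w' n n' : moves p i j w n -> moves q i j w' n' ->
  moves (Seq p q) i j (w ++ w') (n + n').
Proof.
move=> hp hq r m s ij hm; rewrite -(moved_cat _ _ _ (w' ++ s)) //.
apply: ExSeq; first by apply: hp => //; rewrite hm -catA.
by apply: hq; rewrite ?moved_src.
Qed.

Lemma mvP x i j : moves (mv i j) i j [:: x] 2.
Proof.
move=> r m s ij hm; have e : tops m i = Some x by rewrite /tops hm.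
apply: exec_conv (ExSeq (ExPush _ _ _ _) (ExPop _ _ _)) _ _ => //.
by rewrite e /moved upd_neq 1?eq_sym // hm.
Qed.

Lemma mvwP (P : pred sym) i j w r m s : i != j -> m i = w ++ s -> all P w ->
  ~~ (if s is x :: _ then P x else false) ->
  exec (mvw P i j) r m (3 * size w + 1) r (moved m i j w s).
Proof.
move=> ij + + hs; elim: w m => [|x w IHw] m hm hw.
  apply: exec_conv (ExWhileF _ _) _ _ => //.
    by rewrite /on_top /tops hm; case: s hs {hm}.
  apply: functional_extensionality => k; rewrite /moved /upd.
  by case: eqP => [->|_]; rewrite ?hm //; case: eqP => // ->.
case/andP: hw => hx hw.
have hmv : exec (mv i j) r m 2 r (moved m i j [:: x] (w ++ s)) by apply: mvP.
have := IHw _ (moved_src _ _ _ _ _) hw; move=> /(_ m j [:: x]) h.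
apply: exec_conv (ExWhileT _ hmv h) _ _.
- by rewrite /on_top /tops hm.
- rewrite /=; lia.
- by rewrite moved_cat.
Qed.

Definition is_dg (x : sym) : bool := if x is Some (Some _) then true else false.

Definition mvint i j : program := Seq (mvw is_dg i j) (mv i j).
Definition mvpt i j : program := Seq (mvint i j) (mvint i j).
(** An encoded point begins with a digit, its sign, so one symbol tells whether another point
    follows. *)
Definition mvpts i j : program := While (on_top is_dg i) (mvpt i j).
Definition mvconf i j : program := Seq (mvpts i j) (mv i j).
Definition mvall i j : program := mvw predT i j.

Lemma mvallP i j r m : i != j ->
  exec (mvall i j) r m (3 * size (m i) + 1) r (moved m i j (m i) [::]).
Proof. by move=> ij; apply: mvwP; rewrite ?cats0 ?all_predT. Qed.

End Moves.

(** * Encoded integers, points and configurations *)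

Definition e_int (z : int) : seq sym := map emb (enc_int z).
Definition e_pt (p : point) : seq sym := map emb (enc_point p).
Definition e_conf (s : seq point) : seq sym := map emb (enc_config s).

Fixpoint bval (bs : seq bool) : nat := if bs is b :: bs then b + (bval bs).*2 else 0.
Definition dval (sg : bool) (bs : seq bool) : int :=
  if sg then (- (Posz (bval bs)))%R else (Posz (bval bs)).

Lemma bits_auxP k n : n <= k ->
  exists2 bs, map emb (bits_aux k n) = map (fun b => Dg b) bs & bval bs = n.
Proof.
elim: k n => [|k IHk] [|n] hn; try by exists [::].
have [|bs e v] := IHk (n.+1)./2; first lia.
exists (odd n.+1 :: bs); last by rewrite [LHS]/= v -[RHS]odd_double_half.
by rewrite [LHS]/= e /=; case: (odd n).
Qed.

Lemma e_intP z : exists sg bs,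
  e_int z = map (fun b => Dg b) (sg :: bs) ++ [:: Sp] /\ dval sg bs = z.
Proof.
have [bs e v] := bits_auxP (leqnn (absz z)).
exists (z < 0)%R, bs; split; last by rewrite /dval v; case: ifP; lia.
by rewrite /e_int /enc_int /= map_cat e; case: (z < 0)%R.
Qed.

Lemma e_ptE p : e_pt p = e_int p.1 ++ e_int p.2.
Proof. by rewrite /e_pt map_cat. Qed.

Lemma e_conf_cons p s : e_conf (p :: s) = e_pt p ++ e_conf s.
Proof. by rewrite /e_conf /enc_config /= -catA map_cat. Qed.

Lemma e_conf_nil : e_conf [::] = [:: Sp].
Proof. by []. Qed.

Lemma e_pt_head p : exists sg w, e_pt p = Dg sg :: w.
Proof. by rewrite e_ptE; have [sg [bs [-> _]]] := e_intP p.1; do 2!eexists. Qed.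

Lemma e_conf_digits c : all (predC1 Gp) (e_conf c).
Proof. by rewrite /e_conf; elim: (enc_config c) => // -[].
Qed.

Lemma mvintP i j z : moves (mvint i j) i j (e_int z) (3 * size (e_int z)).
Proof.
have [sg [bs [-> _]]] := e_intP z; move=> r m s ij hm.
rewrite -(moved_cat _ _ _ (Sp :: s)) //.
apply: exec_conv (ExSeq (mvwP _ ij _ _ _) (@mvP Sp i j r _ s _ _)) _ _ => //.
- by rewrite hm -catA.
- by rewrite all_map; apply/allP.
- by [].
- by rewrite moved_src.
- by rewrite size_cat /=; lia.
Qed.

Lemma mvptP i j p : moves (mvpt i j) i j (e_pt p) (3 * size (e_pt p)).
Proof.
rewrite e_ptE size_cat mulnDr; apply: moves_seq; exact: mvintP.
Qed.

Definition e_pts (c : seq point) : seq sym := flatten (map e_pt c).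

Lemma e_pts_cons p c : e_pts (p :: c) = e_pt p ++ e_pts c.
Proof. by []. Qed.

Lemma e_confE c : e_conf c = e_pts c ++ [:: Sp].
Proof. by rewrite /e_conf /enc_config map_cat map_flatten -map_comp. Qed.

Lemma mvptsP i j c r m s : i != j -> m i = e_pts c ++ s ->
  ~~ (if s is x :: _ then is_dg x else false) ->
  exec (mvpts i j) r m (4 * size (e_pts c) + 1) r (moved m i j (e_pts c) s).
Proof.
move=> ij + hs; elim: c m => [|p c IHc] m hm.
  apply: exec_conv (ExWhileF _ _) _ _ => //.
    by rewrite /on_top /tops hm; case: s hs {hm}.
  apply: functional_extensionality => k; rewrite /moved /upd.
  by case: eqP => [->|_]; rewrite ?hm //; case: eqP => // ->.
rewrite e_pts_cons -catA in hm *.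
apply: exec_conv (ExWhileT _ (mvptP r ij hm) (IHc _ (moved_src _ _ _ _ _))) _ _.
- by have [sg [w e]] := e_pt_head p; rewrite /on_top /tops hm e.
- have [sg [w e]] := e_pt_head p; rewrite size_cat e [size (_ :: _)]/=; lia.
- by rewrite moved_cat.
Qed.

Lemma mvconfP i j c : moves (mvconf i j) i j (e_conf c) (4 * size (e_conf c)).
Proof.
move=> r m s ij hm; rewrite e_confE -(moved_cat _ _ _ (Sp :: s)) //.
apply: exec_conv (ExSeq (mvptsP _ ij _ _) (@mvP Sp i j r _ s _ _)) _ _ => //.
- by rewrite hm e_confE -catA.
- by [].
- by rewrite moved_src.
- by rewrite size_cat /=; lia.
Qed.

(** * The adjacency test *)

(* Keeps simplification from expanding encoded numbers under [++]. *)
Opaque e_int e_pt e_conf.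

Definition mk (u a b x y h : seq sym) : stacks := fun i =>
  match i with SU => u | SA => a | SB => b | SX => x | SY => y | SH => h end.

Lemma updU u a b x y h s : upd (mk u a b x y h) SU s = mk s a b x y h.
Proof. by apply: functional_extensionality; case. Qed.
Lemma updA u a b x y h s : upd (mk u a b x y h) SA s = mk u s b x y h.
Proof. by apply: functional_extensionality; case. Qed.
Lemma updB u a b x y h s : upd (mk u a b x y h) SB s = mk u a s x y h.
Proof. by apply: functional_extensionality; case. Qed.
Lemma updX u a b x y h s : upd (mk u a b x y h) SX s = mk u a b s y h.
Proof. by apply: functional_extensionality; case. Qed.
Lemma updY u a b x y h s : upd (mk u a b x y h) SY s = mk u a b x s h.
Proof. by apply: functional_extensionality; case. Qed.
Lemma updH u a b x y h s : upd (mk u a b x y h) SH s = mk u a b x y s.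
Proof. by apply: functional_extensionality; case. Qed.
Definition updE := (updU, updA, updB, updX, updY, updH).

(* [slot t e] is the remaining tolerance if the parts of the two numbers that
   are not yet read differ by [e]; it vanishes unless [|e| <= 1]. *)
Definition slot (t : tri) (e : int) : 'I_3 :=
  match e with
  | Negz 0 => t.1.1 | Posz 0 => t.1.2 | Posz 1 => t.2 | _ => ord0
  end.

(* The bits arrive with the least significant one first; [d] is the difference
   of the two bits just read. *)
Definition tri_read (t : tri) (d : int) : tri :=
  (slot t (d - 2)%R, slot t d, slot t (d + 2)%R).

Lemma slot_far t e : 1 < absz e -> slot t e = ord0.
Proof. by case: e => [[|[|n]]|[|n]]. Qed.

(** Unread parts that differ by [e] after the step differed by [d + 2 * e] before it. If [|e| >= 2],
    then [|d + 2 * e| >= 2] as well and both sides vanish. *)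
Lemma slot_read t d e : absz d <= 2 -> slot (tri_read t d) e = slot t (d + 2 * e)%R.
Proof.
move=> hd; case: e => [[|[|n]]|[|n]].
- by rewrite [LHS]/=; congr slot; lia.
- by rewrite [LHS]/=; congr slot; lia.
- by rewrite [RHS]slot_far // ; lia.
- by rewrite [LHS]/=; congr slot; lia.
- by rewrite [RHS]slot_far // ; lia.
Qed.

(** What a tolerance [v] leaves after a difference of -1, 0 or 1. *)
Definition tri_init (v : 'I_3) : tri := (inord v.-1, v, inord v.-1).

Lemma slot_init (v : 'I_3) e : slot (tri_init v) e = v - absz e :> nat.
Proof.
have hv := ltn_ord v; have h : v.-1 < 3 by lia.
case: e => [[|[|n]]|[|n]] /=; rewrite ?inordK //; lia.
Qed.

Definition digit (sg b : bool) : int := if b then if sg then (-1)%R else 1%R else 0%R.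
Definition top_digit (o : option sym) : bool := if o is Some (Some (Some b)) then b else false.

Lemma dval_behead sg bs :
  dval sg bs = (digit sg (head false bs) + 2 * dval sg (behead bs))%R.
Proof. by rewrite /dval; case: bs => [|[] bs] /=; case: sg; rewrite ?add1n ?add0n; lia. Qed.

Lemma digit_bound sg b sg' b' : absz (digit sg b - digit sg' b')%R <= 2.
Proof. by case: sg b sg' b' => [] [] [] []. Qed.

(** A separator reads as the digit 0, which pads the shorter number; the digits read are kept on the
    scratch stacks. *)
Definition cmp_body : program :=
  Seq (Assign (fun r c =>
         (tri_read r.1.1 (digit r.1.2.1 (top_digit (c SA)) -
                          digit r.1.2.2 (top_digit (c SX)))%R, r.1.2, r.2)))
  (Seq (If (on_top is_dg SX) (mv SX SY) nop)
       (If (on_top is_dg SA) (mv SA SH) nop)).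

Definition cmp_loop : program :=
  While (fun r c => on_top is_dg SX r c || on_top is_dg SA r c) cmp_body.

Notation Dgs bs := (map (fun b : bool => Some (Some b) : sym) bs).

Lemma if_mvP i j (bs : seq bool) r s (m : stacks) : i != j -> m i = Dgs bs ++ Sp :: s ->
  exec (If (on_top is_dg i) (mv i j) nop) r m 3 r
    (moved m i j (Dgs (take 1 bs)) (Dgs (behead bs) ++ Sp :: s)).
Proof.
move=> ij hm; apply: ExIf; rewrite /on_top /tops hm; case: bs hm => [|b bs] hm /=.
  apply: exec_conv (ExAssign _ _ _) _ _ => //.
  apply: functional_extensionality => k; rewrite /moved /upd.
  by case: eqP => [->|_]; rewrite ?hm //; case: eqP => // ->.
rewrite take0; exact: mvP.
Qed.

Lemma cmp_bodyP t sa sx ok u (bs : seq bool) ra b (ds : seq bool) rx y h :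
  exec cmp_body (t, (sa, sx), ok)
    (mk u (Dgs bs ++ Sp :: ra) b (Dgs ds ++ Sp :: rx) y h) 7
    (tri_read t (digit sa (head false bs) - digit sx (head false ds))%R, (sa, sx), ok)
    (mk u (Dgs (behead bs) ++ Sp :: ra) b (Dgs (behead ds) ++ Sp :: rx)
       (rev (Dgs (take 1 ds)) ++ y) (rev (Dgs (take 1 bs)) ++ h)).
Proof.
pose m := mk u (Dgs bs ++ Sp :: ra) b (Dgs ds ++ Sp :: rx) y h.
set r' := (tri_read _ _, _, _).
have h1 := @if_mvP SX SY ds r' rx m isT erefl.
have h2 := @if_mvP SA SH bs r' ra _ isT (erefl : (moved m SX SY (Dgs (take 1 ds)) (Dgs (behead ds) ++ Sp :: rx)) SA = _).
rewrite /moved /m !updE in h1 h2.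
apply: exec_conv (ExSeq _ (ExSeq h1 h2)) _ _ => //.
have -> : r' = (tri_read t (digit sa (top_digit (tops m SA)) -
    digit sx (top_digit (tops m SX)))%R, (sa, sx), ok).
  by rewrite /r' /m; case: bs {r' m h1 h2}; case: ds.
  exact: ExAssign.
by [].
Qed.

(** The slot at the difference of the unread parts is invariant; once both are used up the
    difference is 0 and the middle slot holds the result. *)
Lemma cmp_loopP t sa sx ok u (bs : seq bool) ra b (ds : seq bool) rx y h n :
  size bs <= n -> size ds <= n ->
  exists2 t', slot t' 0 = slot t (dval sa bs - dval sx ds)%R &
  exec cmp_loop (t, (sa, sx), ok)
    (mk u (Dgs bs ++ Sp :: ra) b (Dgs ds ++ Sp :: rx) y h) (8 * n + 1)
    (t', (sa, sx), ok)
    (mk u (Sp :: ra) b (Sp :: rx) (rev (Dgs ds) ++ y) (rev (Dgs bs) ++ h)).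
Proof.
elim: n t bs ds y h => [|n IHn] t bs ds y h.
  case: bs ds => [|//] [|//] _ _; exists t; last exact: ExWhileF.
  by rewrite /dval; case: (sa); case: (sx).
case e : (nilp bs && nilp ds) => hbs hds.
  case: bs ds e {hbs hds} => [|//] [|//] _; exists t.
    by rewrite /dval; case: (sa); case: (sx).
  by apply: exec_conv (ExWhileF _ _) _ _.
have hbs' : size (behead bs) <= n by rewrite size_behead; lia.
have hds' : size (behead ds) <= n by rewrite size_behead; lia.
pose d := (digit sa (head false bs) - digit sx (head false ds))%R.
have [t' ht' h'] := IHn (tri_read t d) _ _ (rev (Dgs (take 1 ds)) ++ y) (rev (Dgs (take 1 bs)) ++ h) hbs' hds'.
exists t'.
  rewrite ht' slot_read ?digit_bound // (dval_behead sa bs) (dval_behead sx ds).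
  by congr slot; rewrite /d; lia.
apply: exec_conv (ExWhileT _ (cmp_bodyP _ _ _ _ _ _ _ _ _ _ _ _) h') _ _.
- by rewrite /on_top /tops /=; case: (ds) e => //; case: (bs).
- lia.
- by congr mk; rewrite catA -rev_cat; [case: (ds) | case: (bs)] => //= x s; rewrite take0.
Qed.

Definition set_tri (f : reg -> 'I_3) : program :=
  Assign (fun r _ => (tri_init (f r), r.1.2, r.2)).

Definition tol (r : reg) : 'I_3 := r.1.1.1.2.

Definition read_signs : program :=
  Assign (fun r c => (r.1.1, (top_digit (c SA), top_digit (c SX)), r.2)).

(** Rebuilding the triple around its middle slot lets a second comparison continue with the
    tolerance left by the first. *)
Definition cmp_int : program :=
  Seq read_signs
  (Seq (mv SX SY) (Seq (mv SA SH) (Seq cmp_loop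
  (Seq (mv SX SY) (Seq (mv SA SH) (set_tri tol)))))).

Ltac mk_step h t := have h := t; rewrite /moved !updE in h.

Lemma rev_bracket (T : Type) (x z : T) (w y : seq T) :
  rev (x :: w ++ [:: z]) ++ y = z :: rev w ++ x :: y.
Proof. by rewrite rev_cons rev_cat -cats1 -!catA. Qed.

Lemma cmp_intP (v : 'I_3) sg ok u za ra b zx rx y h :
  exists2 r : reg, [/\ tol r = v - absz (za - zx)%R :> nat, r.1.1 = tri_init (tol r) & r.2 = ok] &
  exec cmp_int (tri_init v, sg, ok) (mk u (e_int za ++ ra) b (e_int zx ++ rx) y h)
   (8 * (size (e_int za) + size (e_int zx))) r
   (mk u ra b rx (rev (e_int zx) ++ y) (rev (e_int za) ++ h)).
Proof.
have [sa [bs [-> <-]]] := e_intP za; have [sx [ds [-> <-]]] := e_intP zx.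
have [t ht h4] := @cmp_loopP (tri_init v) sa sx ok u bs ra b ds rx
  (Dg sx :: y) (Dg sa :: h) _ (leq_addr (size ds) _) (leq_addl (size bs) _).
rewrite -!catA /=.
pose r1 : reg := (tri_init v, (sa, sx), ok).
have h1 : exec read_signs (tri_init v, sg, ok) (mk u (Dg sa :: Dgs bs ++ Sp :: ra) b (Dg sx :: Dgs ds ++ Sp :: rx) y h) 1 r1 _ := ExAssign _ _ _.
mk_step h2 (@mvP (Dg sx) SX SY r1 (mk u (Dg sa :: Dgs bs ++ Sp :: ra) b (Dg sx :: Dgs ds ++ Sp :: rx) y h) _ isT erefl).
mk_step h3 (@mvP (Dg sa) SA SH r1 (mk u (Dg sa :: Dgs bs ++ Sp :: ra) b (Dgs ds ++ Sp :: rx) (Dg sx :: y) h) _ isT erefl).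
pose r2 : reg := (t, (sa, sx), ok).
mk_step h5 (@mvP Sp SX SY r2 (mk u (Sp :: ra) b (Sp :: rx) (rev (Dgs ds) ++ Dg sx :: y) (rev (Dgs bs) ++ Dg sa :: h)) _ isT erefl).
mk_step h6 (@mvP Sp SA SH r2 (mk u (Sp :: ra) b rx (Sp :: rev (Dgs ds) ++ Dg sx :: y) (rev (Dgs bs) ++ Dg sa :: h)) _ isT erefl).
pose r3 : reg := (tri_init (slot t 0), (sa, sx), ok).
have h7 m : exec (set_tri tol) r2 m 1 r3 m := ExAssign _ _ _.
exists r3.
  by split=> //; rewrite -slot_init -ht.
apply: exec_conv (ExSeq h1 (ExSeq h2 (ExSeq h3 (ExSeq h4 (ExSeq h5 (ExSeq h6 (h7 _))))))) _ _.
  by rewrite !size_cat !size_map /=; lia.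
by congr mk; rewrite [RHS]rev_bracket.
Qed.

Definition hit (r : reg) : bool := 0 < tol r.

(** The tolerance starts at [ord_max], which is 2, and each coordinate takes off its distance: it
    stays positive exactly when the distances sum to at most 1. The last two moves restore both
    points. *)
Definition test : program :=
  Seq (set_tri (fun _ => ord_max))
  (Seq cmp_int (Seq cmp_int (Seq (mvall SY SX) (mvall SH SA)))).

Lemma grid_moveE s t :
  grid_move s t = (absz (t.1 - s.1)%R + absz (t.2 - s.2)%R < 2).
Proof.
rewrite /grid_move; case: s t => [s1 s2] [t1 t2] /=.
by rewrite xpair_eqE; lia.
Qed.

Lemma testP r u t ra b s :
  exists2 r' : reg, hit r' = grid_move s t /\ r'.2 = r.2 &
  exec test r (mk u (e_pt t ++ ra) b (e_pt s) [::] [::])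
   (12 * (size (e_pt t) + size (e_pt s))) r'
   (mk u (e_pt t ++ ra) b (e_pt s) [::] [::]).
Proof.
have [r1 [v1 e1 ok1] h1] := @cmp_intP ord_max r.1.2 r.2 u t.1 (e_int t.2 ++ ra) b
  s.1 (e_int s.2) [::] [::].
case: r1 v1 e1 ok1 h1 => [[tr sg] ok] v1 e1 ok1 h1.
rewrite /= in e1 ok1.
have [r2 [v2 e2 ok2] h2] := @cmp_intP (tol (tr, sg, ok)) sg ok u t.2 ra b
  s.2 [::] (rev (e_int s.1) ++ [::]) (rev (e_int t.1) ++ [::]).
mk_step h3 (@mvallP SY SX r2 (mk u ra b [::] (rev (e_pt s)) (rev (e_pt t))) isT).
mk_step h4 (@mvallP SH SA r2 (mk u ra b (e_pt s) [::] (rev (e_pt t))) isT).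
exists r2.
  by split; [rewrite /hit v2 v1 grid_moveE /=; lia | rewrite ok2].
rewrite -e1 !cats0 -!rev_cat -!e_ptE in h2.
rewrite !cats0 catA -!e_ptE in h1.
rewrite !revK cats0 in h3 h4.
have h0 m : exec (set_tri (fun _ => ord_max)) r m 1 (tri_init ord_max, r.1.2, r.2) m := ExAssign _ _ _.
apply: exec_conv (ExSeq (h0 _) (ExSeq h1 (ExSeq h2 (ExSeq h3 h4)))) _ _ => //.
rewrite !size_rev !e_ptE !size_cat.
have [sa [bs [-> _]]] := e_intP t.1; have [sx [ds [-> _]]] := e_intP s.1.
rewrite !size_cat /=; lia.
Qed.

(** * One bid *)

(** A target and its owner form a configuration of one or two points, so that [mvconf] moves the
    whole record. *)
Definition e_item (x : item) : seq sym :=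
  if x is Some (t, o) then e_conf (t :: seq_of_opt o) else [:: Gp].
Definition e_items (A : seq item) : seq sym := flatten (map e_item A).

Lemma e_items_cons x A : e_items (x :: A) = e_item x ++ e_items A.
Proof. by []. Qed.

Lemma e_items_cat A B : e_items (A ++ B) = e_items A ++ e_items B.
Proof. by rewrite /e_items map_cat flatten_cat. Qed.

Lemma e_item_some t o : e_item (Some (t, o)) = e_pt t ++ e_conf (seq_of_opt o).
Proof. exact: e_conf_cons. Qed.

Lemma e_item_head x : exists a w, e_item x = a :: w /\ (a == Gp) = is_sep x.
Proof.
case: x => [[t o]|]; last by exists Gp, [::].
by have [sg [w e]] := e_pt_head t; exists (Dg sg), (w ++ e_conf (seq_of_opt o)); rewrite /= e_conf_cons e.
Qed.

Lemma size_e_item x : 0 < size (e_item x).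
Proof. by have [a [w [-> _]]] := e_item_head x. Qed.

Definition scan_body : program :=
  If (on_top (pred1 Gp) SA) (mv SA SB)
     (Seq test (If (fun r _ => hit r) nop (mvconf SA SB))).

Definition scan : program :=
  While (fun r c => isSome (c SA) && ~~ hit r) scan_body.

Lemma scan_bodyP r u x ra b s : ~~ hit r ->
  exists2 r' : reg, hit r' = adjacent s x /\ r'.2 = r.2 &
  exec scan_body r (mk u (e_item x ++ ra) b (e_pt s) [::] [::])
    (18 * (size (e_item x) * (size (e_pt s)).+1)) r'
    (if adjacent s x then mk u (e_item x ++ ra) b (e_pt s) [::] [::]
     else mk u ra (rev (e_item x) ++ b) (e_pt s) [::] [::]).
Proof.
move=> hr; case: x => [[t o]|]; rewrite [adjacent _ _]/=; last first.
  exists r; first by split=> //; apply: negbTE.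
  mk_step h (@mvP Gp SA SB r (mk u (Gp :: ra) b (e_pt s) [::] [::]) _ isT erefl).
  by apply: exec_conv (ExIf (b := on_top (pred1 Gp) SA) _) _ _; [exact: h|rewrite [size (e_item None)]/=; lia|].
have [r' [hh hok] h1] := testP r u t (e_conf (seq_of_opt o) ++ ra) b s.
exists r' => //.
rewrite e_item_some -catA.
have [sg [w e]] := e_pt_head t.
have h2 : exec (If (fun r _ => hit r) nop (mvconf SA SB)) r'
   (mk u (e_pt t ++ e_conf (seq_of_opt o) ++ ra) b (e_pt s) [::] [::])
   (4 * size (e_pt t ++ e_conf (seq_of_opt o)) + 1) r'
   (if grid_move s t then mk u (e_pt t ++ e_conf (seq_of_opt o) ++ ra) b (e_pt s) [::] [::]
     else mk u ra (rev (e_pt t ++ e_conf (seq_of_opt o)) ++ b) (e_pt s) [::] [::]).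
  rewrite addn1; apply: ExIf; rewrite hh; case: ifP => _.
    by apply: ExWeak (ExAssign _ _ _) _; rewrite e size_cat [size (_ :: w)]/=; lia.
  rewrite -e_conf_cons.
  mk_step h (@mvconfP SA SB (t :: seq_of_opt o) r' (mk u (e_conf (t :: seq_of_opt o) ++ ra) b (e_pt s) [::] [::]) _ isT erefl).
  by rewrite e_conf_cons -catA in h *.
apply: exec_conv (ExIf (b := on_top (pred1 Gp) SA) _) _ erefl.
  have -> : on_top (pred1 Gp) SA r (tops (mk u (e_pt t ++ e_conf (seq_of_opt o) ++ ra) b (e_pt s) [::] [::])) = false.
    by rewrite e.
  exact: ExSeq h1 h2.
have hpos := size_e_item (Some (t, o)); rewrite e_item_some in hpos.
move: hpos; rewrite size_cat; nia.
Qed.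

Lemma scanP r u P Q b s : ~~ hit r -> ~~ has (adjacent s) P ->
  (if Q is x :: _ then adjacent s x else true) ->
  exists2 r' : reg, r'.2 = r.2 &
  exec scan r (mk u (e_items (P ++ Q)) b (e_pt s) [::] [::])
    (20 * (size (e_items (P ++ Q)) * (size (e_pt s)).+1) + 1) r'
    (mk u (e_items Q) (rev (e_items P) ++ b) (e_pt s) [::] [::]).
Proof.
move=> + + hQ; elim: P r b => [|x P IHP] r b hr hP.
  case: Q hQ => [|x Q] hQ; first by exists r => //; apply: exec_conv (ExWhileF _ _) _ _.
  rewrite cat0s e_items_cons.
  have [r' [hh hok] h] := scan_bodyP u x (e_items Q) b s hr.
  rewrite hQ in hh h; exists r' => //.
  have [a [w [e _]]] := e_item_head x.
  apply: exec_conv (ExWhileT _ h (ExWhileF _ _)) _ _ => //.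
  - by rewrite /tops /= e.
  - by rewrite hh andbF.
  (* The positive product absorbs the overhead of the loop. *)
  - have hpos : 0 < size (e_item x) * (size (e_pt s)).+1 by rewrite muln_gt0 size_e_item.
  by rewrite size_cat mulnDl; lia.
have /norP [hx {}hP] : ~~ (adjacent s x || has (adjacent s) P) := hP.
rewrite cat_cons e_items_cons.
have [r' [hh hok] h] := scan_bodyP u x (e_items (P ++ Q)) b s hr.
rewrite (negbTE hx) in hh h.
have [r2 hok2 h2] := IHP r' (rev (e_item x) ++ b) (negbT hh) hP.
have [a [w [e _]]] := e_item_head x.
exists r2; first by rewrite hok2.
apply: exec_conv (ExWhileT _ h h2) _ _.
- by rewrite /tops /= e hr.
- have hpos : 0 < size (e_item x) * (size (e_pt s)).+1 by rewrite muln_gt0 size_e_item.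
  by rewrite size_cat mulnDl; lia.
- by rewrite e_items_cons rev_cat catA.
Qed.

Definition fail : program := Assign (fun r _ => (r.1, false)).

(** Stacks fill from the bottom: once the separator is set aside, the terminator, the owner and the
    target are pushed in this order, and the scanned items return on top, the separator first. *)
Definition place : program :=
  Seq (mv SA SB) (Seq (Push SA (fun _ _ => Sp)) (Seq (mvall SX SY)
  (Seq (mvall SY SA) (Seq (mvall SH SA) (mvall SB SA))))).

Definition evict : program :=
  If (on_top is_dg SA) (Seq (mvpt SA SY) (mvall SY SU)) nop.

(** If [SA] is empty after the skip to the next [Gp], no separator follows the target: its price is
    at the bound and the auction fails. *)
Definition take_target : program :=
  Seq (mvpt SA SH) (Seq evict (Seq (Pop _ _ SA) (Seq (mvw (predC1 Gp) SA SB)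
  (If (on_top predT SA) place fail)))).

Lemma e_items_nosep Q : ~~ has is_sep Q -> all (predC1 Gp) (e_items Q).
Proof.
elim: Q => // -[[t o]|] Q IH // hQ.
by rewrite e_items_cons all_cat IH // andbT e_conf_digits.
Qed.

Lemma placeP r u A2 b s t :
  exec place r (mk u (Gp :: A2) b (e_pt s) [::] (rev (e_pt t)))
    (20 + 10 * (size (e_pt s) + size (e_pt t) + size b)) r
    (mk u (rev b ++ e_items [:: None; Some (t, Some s)] ++ A2) [::] [::] [::] [::]).
Proof.
mk_step h1 (@mvP Gp SA SB r (mk u (Gp :: A2) b (e_pt s) [::] (rev (e_pt t))) _ isT erefl).
have h2 := ExPush SA (fun _ _ => Sp) r (mk u A2 (Gp :: b) (e_pt s) [::] (rev (e_pt t))).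
rewrite updE in h2.
mk_step h3 (@mvallP SX SY r (mk u (Sp :: A2) (Gp :: b) (e_pt s) [::] (rev (e_pt t))) isT).
mk_step h4 (@mvallP SY SA r (mk u (Sp :: A2) (Gp :: b) [::] (rev (e_pt s) ++ [::]) (rev (e_pt t))) isT).
rewrite !cats0 revK in h3 h4.
mk_step h5 (@mvallP SH SA r (mk u (e_pt s ++ Sp :: A2) (Gp :: b) [::] [::] (rev (e_pt t))) isT).
rewrite revK in h5.
mk_step h6 (@mvallP SB SA r (mk u (e_pt t ++ e_pt s ++ Sp :: A2) (Gp :: b) [::] [::] [::]) isT).
apply: exec_conv (ExSeq h1 (ExSeq h2 (ExSeq h3 (ExSeq h4 (ExSeq h5 h6))))) _ _.
  by rewrite /= !size_rev; lia.
congr mk; rewrite !e_items_cons /e_item !e_conf_cons.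
by rewrite rev_cons -cats1 -!catA.
Qed.

Lemma evictP r U o Q b x h :
  exec evict r (mk (e_conf U) (e_conf (seq_of_opt o) ++ Q) b x [::] h)
    (6 * size (e_conf (seq_of_opt o)) + 6) r
    (mk (e_conf (seq_of_opt o ++ U)) (Sp :: Q) b x [::] h).
Proof.
case: o => [s|]; last first.
  rewrite [seq_of_opt _]/= e_conf_nil.
  have h0 : exec evict r (mk (e_conf U) (Sp :: Q) b x [::] h) 2 r
      (mk (e_conf U) (Sp :: Q) b x [::] h).
    by apply: ExIf; apply: (ExAssign (fun r _ => r)).
  by apply: ExWeak h0 _.
rewrite [seq_of_opt _]/= cat1s !e_conf_cons e_conf_nil -catA.
mk_step h1 (@mvptP SA SY s r (mk (e_conf U) (e_pt s ++ Sp :: Q) b x [::] h) _ isT erefl).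
mk_step h2 (@mvallP SY SU r (mk (e_conf U) (Sp :: Q) b x (rev (e_pt s)) h) isT).
rewrite /= cats0 in h1; rewrite revK in h2.
apply: exec_conv (ExIf (b := on_top is_dg SA) _) _ erefl.
  have -> : on_top is_dg SA r (tops (mk (e_conf U) (e_pt s ++ [:: Sp] ++ Q) b x [::] h)).
    by have [sg [w e]] := e_pt_head s; rewrite e.
  exact: ExSeq h1 h2.
by rewrite /= size_rev size_cat; lia.
Qed.

Section Take.
Variables (r : reg) (U : seq point) (t : point) (o : option point) (Q : seq item).
Variables (b : seq sym) (s : point).
Hypothesis (nsQ : ~~ has is_sep Q).

(** The part common to a successful and a failed bid; the final branch enters as a hypothesis. *)
Lemma take_prefix A' : (if A' is x :: _ then x == Gp else true) ->
  forall n r' m', exec (If (on_top predT SA) place fail) r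
    (mk (e_conf (seq_of_opt o ++ U)) A' (rev (e_items Q) ++ b) (e_pt s) [::] (rev (e_pt t)))
    n r' m' ->
  exec take_target r (mk (e_conf U) (e_items (Some (t, o) :: Q) ++ A') b (e_pt s) [::] [::])
    (10 * size (e_items (Some (t, o) :: Q)) + 20 + n) r' m'.
Proof.
move=> hA' n r' m' h5.
rewrite e_items_cons e_item_some -!catA.
mk_step h1 (@mvptP SA SH t r (mk (e_conf U) (e_pt t ++ e_conf (seq_of_opt o) ++ e_items Q ++ A') b (e_pt s) [::] [::]) _ isT erefl).
rewrite /= cats0 in h1.
have h2 := evictP r U o (e_items Q ++ A') b (e_pt s) (rev (e_pt t)).
have h3 := ExPop SA r (mk (e_conf (seq_of_opt o ++ U)) (Sp :: e_items Q ++ A') b (e_pt s) [::] (rev (e_pt t))).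
rewrite updE in h3.
have h4 := @mvwP (predC1 Gp) SA SB (e_items Q) r
  (mk (e_conf (seq_of_opt o ++ U)) (e_items Q ++ A') b (e_pt s) [::] (rev (e_pt t))) A' isT erefl (e_items_nosep nsQ).
have {}h4 := h4 _; rewrite /moved !updE in h4.
apply: exec_conv (ExSeq h1 (ExSeq h2 (ExSeq h3 (ExSeq (h4 _) h5)))) _ erefl.
  by case: (A') hA' => //= a w ->.
by rewrite !size_cat /=; lia.
Qed.

Lemma take_bid Q2 :
  exec take_target r
    (mk (e_conf U) (e_items (Some (t, o) :: Q ++ None :: Q2)) b (e_pt s) [::] [::])
    (20 * (size (e_items (Some (t, o) :: Q)) + size b + size (e_pt s)) + 50) r
    (mk (e_conf (seq_of_opt o ++ U)) (rev b ++ e_items (Q ++ None :: Some (t, Some s) :: Q2))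
       [::] [::] [::] [::]).
Proof.
have hp := placeP r (e_conf (seq_of_opt o ++ U)) (e_items Q2) (rev (e_items Q) ++ b) s t.
have hif := @ExIf _ _ _ (on_top predT SA) place fail r (mk (e_conf (seq_of_opt o ++ U))
    (e_items (None :: Q2)) (rev (e_items Q) ++ b) (e_pt s) [::] (rev (e_pt t))) _ _ _ hp.
rewrite -cat_cons !e_items_cat.
apply: exec_conv (@take_prefix (e_items (None :: Q2)) isT _ _ _ hif) _ _.
  by rewrite e_items_cons e_item_some !size_cat size_rev; lia.
by rewrite rev_cat revK -catA -(e_items_cat [:: None; _]).
Qed.

Lemma take_last : exists m,
  exec take_target r
    (mk (e_conf U) (e_items (Some (t, o) :: Q)) b (e_pt s) [::] [::])
    (20 * (size (e_items (Some (t, o) :: Q)) + size b + size (e_pt s)) + 50) (r.1, false) m.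
Proof.
pose m := mk (e_conf (seq_of_opt o ++ U)) [::] (rev (e_items Q) ++ b) (e_pt s) [::] (rev (e_pt t)).
have hif : exec (If (on_top predT SA) place fail) r m 2 (r.1, false) m.
  by apply: ExIf; exact: (ExAssign (fun r _ => (r.1, false))).
exists m; rewrite -[e_items _]cats0.
apply: exec_conv (take_prefix _ hif) _ erefl => //.
by rewrite cats0; lia.
Qed.
End Take.

(** * The auction as a stack program *)

(** The tolerance is reset to 0 because [scan] runs only as long as there is no hit; the detour
    through [SY] keeps the source upright. *)
Definition round : program :=
  Seq (set_tri (fun _ => ord0)) (Seq (mvpt SU SY) (Seq (mvall SY SX)
  (Seq scan (If (on_top predT SA) take_target fail)))).

(** Quadratic, since comparing the source with all items is bounded by the product of the lengths;
    100 is generous. *)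
Definition round_cost (z : nat) : nat := 100 * z.+1 ^ 2.

Definition home (U : seq point) (A : seq item) : stacks :=
  mk (e_conf U) (e_items A) [::] [::] [::] [::].

Definition home_size (U : seq point) (A : seq item) : nat :=
  size (e_conf U) + size (e_items A).

Lemma round_prefix r s U P Q : ~~ has (adjacent s) P ->
  (if Q is x :: _ then adjacent s x else true) ->
  exists2 r1 : reg, r1.2 = r.2 & forall n r' m',
  exec (if Q is [::] then fail else take_target) r1
    (mk (e_conf U) (e_items Q) (rev (e_items P)) (e_pt s) [::] [::]) n r' m' ->
  exec round r (home (s :: U) (P ++ Q))
    (6 * size (e_pt s) + 20 * (size (e_items (P ++ Q)) * (size (e_pt s)).+1) + 4 + n) r' m'.
Proof.
move=> hP hQ.
pose r0 : reg := (tri_init ord0, r.1.2, r.2).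
have h1 m : exec (set_tri (fun _ => ord0)) r m 1 r0 m := ExAssign _ _ _.
mk_step h2 (@mvptP SU SY s r0 (mk (e_pt s ++ e_conf U) (e_items (P ++ Q)) [::] [::] [::] [::]) _ isT erefl).
mk_step h3 (@mvallP SY SX r0 (mk (e_conf U) (e_items (P ++ Q)) [::] [::] (rev (e_pt s)) [::]) isT).
rewrite /= cats0 in h2; rewrite revK /= cats0 in h3.
have hr0 : ~~ hit r0 by [].
have [r1 hr1 h4] := scanP (e_conf U) [::] hr0 hP hQ.
rewrite cats0 in h4.
exists r1 => [|n r' m' h]; first by rewrite hr1.
rewrite /home e_conf_cons.
apply: exec_conv (ExSeq (h1 _) (ExSeq h2 (ExSeq h3 (ExSeq h4
  (@ExIf _ _ _ (on_top predT SA) take_target fail _ _ n _ _ _))))) _ erefl.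
  case: Q hQ h {h2 h3 h4} => // x Q _.
  by have [a [w [e _]]] := e_item_head x; rewrite e_items_cons e.
by rewrite size_rev /=; lia.
Qed.

Lemma round_cost_bound a x y : y <= a ->
  6 * x + 20 * (a * x.+1) + 4 + (20 * (y + x) + 50) <= round_cost (x + a).
Proof. by move=> h; rewrite /round_cost; nia. Qed.

Lemma round_cost_mono y z : y <= z -> round_cost y <= round_cost z.
Proof. by move=> h; rewrite leq_mul2l /= leq_exp2r. Qed.

Lemma round_stuck r s U A : stuck s A ->
  exists r' m, r'.2 = false /\ exec round r (home (s :: U) A) (round_cost (home_size (s :: U) A)) r' m.
Proof.
have hc : size (e_pt s) + size (e_items A) <= home_size (s :: U) A.
  by rewrite /home_size e_conf_cons size_cat leq_add2r leq_addr.
case=> [[P [t [o [Q [eA hP hst hQ]]]]]|hA].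
  have [r1 hr1 h] := @round_prefix r s U P (Some (t, o) :: Q) hP hst.
  have [m hm] := take_last r1 U t o (rev (e_items P)) s hQ.
  exists (r1.1, false), m; split=> //; rewrite eA in hc *.
  apply: ExWeak (h _ _ _ hm) _; apply: leq_trans (round_cost_mono hc).
  apply: round_cost_bound; rewrite size_rev e_items_cat size_cat; lia.
have [r1 hr1 h] := @round_prefix r s U A [::] hA isT.
have hm := ExAssign (fun r _ => (r.1, false)) r1 (mk (e_conf U) (e_items [::]) (rev (e_items A)) (e_pt s) [::] [::]).
exists (r1.1, false); eexists; split=> //.
rewrite -{1}[A]cats0; apply: ExWeak (h _ _ _ hm) _; apply: leq_trans (round_cost_mono hc).
apply: leq_trans (round_cost_bound _ (leq0n _)).
by rewrite cats0; lia.
Qed.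

Lemma round_bid r s U P t o Q1 Q2 :
  let A := P ++ Some (t, o) :: Q1 ++ None :: Q2 in
  ~~ has (adjacent s) P -> grid_move s t -> ~~ has is_sep Q1 ->
  exists r', r'.2 = r.2 /\ exec round r (home (s :: U) A) (round_cost (home_size (s :: U) A)) r'
    (home (seq_of_opt o ++ U) (P ++ Q1 ++ None :: Some (t, Some s) :: Q2)).
Proof.
move=> A hP hst hQ.
have hc : size (e_pt s) + size (e_items A) <= home_size (s :: U) A.
  by rewrite /home_size e_conf_cons size_cat leq_add2r leq_addr.
have [r1 hr1 h] := @round_prefix r s U P (Some (t, o) :: Q1 ++ None :: Q2) hP hst.
have hm := take_bid r1 U t o (rev (e_items P)) s hQ Q2.
exists r1; split=> //.
apply: exec_conv (h _ _ _ hm) _ _.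
  apply: leq_trans (round_cost_mono hc).
  apply: round_cost_bound; rewrite size_rev /A -cat_cons !e_items_cat !size_cat; lia.
by rewrite revK /home -e_items_cat.
Qed.

(** The source enters the list and the evicted owner, if any, leaves it, so one cost bound serves
    every round. *)
Lemma home_size_bid s U P t o Q1 Q2 :
  home_size (seq_of_opt o ++ U) (P ++ Q1 ++ None :: Some (t, Some s) :: Q2) =
  home_size (s :: U) (P ++ Some (t, o) :: Q1 ++ None :: Q2).
Proof.
rewrite /home_size !e_items_cat !e_items_cons !e_items_cat !e_items_cons.
rewrite !e_item_some e_conf_cons; case: o => [s'|]; rewrite /= !e_conf_cons !e_conf_nil !size_cat /= !size_cat /=; lia.
Qed.

(** * Potential argument and correctness of the main loop *)

Definition price_sum (L : seq priced) : nat := \sum_(x <- L) x.1.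

Section Main.
Variables Cs Ct : seq point.
Hypotheses (uCs : uniq Cs) (uCt : uniq Ct) (eqs : size Cs = size Ct).

(** Only the moved record changes its price: the items of [Q1] and [Q2] keep the same number of
    separators in front of them. *)
Lemma auction_inv_step s U P t o Q1 Q2 :
  let A := P ++ Some (t, o) :: Q1 ++ None :: Q2 in
  let A' := P ++ Q1 ++ None :: Some (t, Some s) :: Q2 in
  ~~ has (adjacent s) P -> grid_move s t -> ~~ has is_sep Q1 ->
  auction_inv Cs Ct (s :: U) (recs 0 A) ->
  [/\ auction_inv Cs Ct (seq_of_opt o ++ U) (recs 0 A'),
      price_sum (recs 0 A') = (price_sum (recs 0 A)).+1 & nsep A' = nsep A].
Proof.
move=> A A' hP hst hQ hinv.
have q0 : nsep Q1 = 0 by apply/eqP; rewrite -leqn0 leqNgt -has_count.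
set k := nsep P.
pose L := recs 0 P ++ recs k Q1 ++ recs k.+1 Q2.
have pA : perm_eq (recs 0 A) ((k, (t, o)) :: L).
  rewrite /A recs_cat add0n /= recs_cat q0 addn0 /=.
  by rewrite -cat1s perm_catCA.
have pA' : perm_eq ((k.+1, (t, Some s)) :: L) (recs 0 A').
  rewrite /A' !recs_cat add0n q0 addn0 /= perm_sym.
  by rewrite catA -cat1s perm_catCA /L /= !catA.
have hb : auction_inv Cs Ct (s :: U) ((k, (t, o)) :: L) by apply: auction_inv_perm hinv.
split.
(* The price [k] is minimal for [s]: nothing in [P] is adjacent, and all later targets cost at least
   [k]. *)
- apply: auction_inv_perm pA' _; apply: auction_inv_bid hb hst _ => y.
  rewrite !mem_cat => /or3P [|/recs_bounds /andP []|/recs_bounds /andP []] //.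
    move=> /mem_recs hy hyt; case/negP: hP; apply/hasP; exists (Some y.2) => //.
    by move: hyt; rewrite /target /=; case: (y.2).
  by move=> h _ _; apply: ltnW.
- by rewrite /price_sum -(perm_big _ pA') (perm_big _ pA) /= !big_cons /= addSn.
- by rewrite /nsep /A /A' !count_cat /= !count_cat /=; lia.
Qed.

Definition main : program :=
  While (fun r c => on_top is_dg SU r c && r.2) round.

Lemma price_sum_bound U A N : nsep A = N -> auction_inv Cs Ct U (recs 0 A) ->
  price_sum (recs 0 A) <= size Ct * N.
Proof.
move=> hN [/perm_size h1 _ _ _ _]; rewrite size_map in h1; rewrite -h1 /price_sum.
rewrite -sum1_size big_distrl /= big_seq [X in _ <= X]big_seq.
by apply: leq_sum => x /recs_bounds /andP [_]; rewrite mul1n hN.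
Qed.

Lemma stuck_reject s U A : auction_inv Cs Ct (s :: U) (recs 0 A) ->
  size Ct <= nsep A -> stuck s A -> ~ transformation Cs Ct.
Proof.
move=> hinv hN hst; apply: (auction_reject uCs uCt eqs hinv hN) => x hx hsx.
have hA : has (adjacent s) A.
  apply/hasP; exists (Some x.2); first exact: mem_recs hx.
  by move: hsx; rewrite /target /=; case: (x.2).
case: hst => [[P [t [o [Q [eA hP _ hQ]]]]]|]; last by rewrite hA.
have q0 : nsep Q = 0 by apply/eqP; rewrite -leqn0 leqNgt -has_count.
move: hx; rewrite eA recs_cat mem_cat => /orP [/mem_recs hx|].
  case/negP: hP; apply/hasP; exists (Some x.2) => //.
  by move: hsx; rewrite /target /=; case: (x.2).
have -> : nsep (P ++ Some (t, o) :: Q) = nsep P.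
  by rewrite /nsep in q0 *; rewrite count_cat /= q0 !addn0.
by move/recs_bounds => /andP [].
Qed.

(** The budget [d] bounds the bids still possible: each raises the sum of the prices by one, and
    that sum is at most [size Ct * N]. *)
Lemma mainP N d U A (r : reg) : size Ct <= N -> nsep A = N ->
  auction_inv Cs Ct U (recs 0 A) -> r.2 ->
  size Ct * N <= price_sum (recs 0 A) + d ->
  exists (r' : reg) m, (r'.2 <-> transformation Cs Ct) /\
    exec main r (home U A) (d.+1 * (round_cost (home_size U A)).+1 + 1) r' m.
Proof.
move=> hN; elim: d.+1 {-2}d (ltnSn d) U A r => // D IHD {}d hdD U A r hA hinv hr hd.
case: U hinv => [|s U] hinv.
  exists r, (home [::] A); split; first by split=> // _; exact: (auction_accept uCs uCt eqs hinv).
  apply: ExWeak (ExWhileF _ _) _; last by rewrite addn1.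
  by rewrite /on_top /tops /= e_conf_nil.
have htop (r0 : reg) B : on_top is_dg SU r0 (tops (home (s :: U) B)).
  by rewrite /on_top /tops /home e_conf_cons; have [sg [w ->]] := e_pt_head s.
have [hst|P t o Q1 Q2 eA hP hst hQ] := choiceP s A.
  have [r' [m [hr' hm]]] := round_stuck r U hst; exists r', m; split.
    rewrite hr'; split=> // htr; case: (stuck_reject hinv _ hst htr).
    by rewrite hA.
  apply: exec_conv (ExWhileT _ hm (ExWhileF _ _)) _ _ => //.
  - by rewrite htop hr.
  - by rewrite hr' andbF.
  - by rewrite mulSn; lia.
have [r1 [hr1 h1]] := round_bid r U o Q2 hP hst hQ.
rewrite eA in hinv hA hd *.
have [hinv' hs hA'] := auction_inv_step hP hst hQ hinv.
have := price_sum_bound hA' hinv'; rewrite hA hs => hb.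
(* With no budget left, this bid would push the sum of the prices beyond its bound. *)
case: d hdD hd => [|d] hdD hd; first lia.
have [||||r' [m [hr' hm]]] := IHD d _ _ _ r1 _ hinv' _ _ => //.
- by rewrite hA'.
- by rewrite hr1.
- by rewrite hs; lia.
exists r', m; split=> //.
apply: exec_conv (ExWhileT _ h1 hm) _ _ => //.
  by rewrite htop hr.
by rewrite home_size_bid [d.+2 * _]mulSn; lia.
Qed.

End Main.

(** * Reading the input *)

(** One separator per input symbol makes [N] the length of the input, which is at least the number
    of targets. *)
Definition seps : program :=
  While (on_top predT SU) (Seq (Push SA (fun _ _ => Gp)) (mv SU SB)).

Definition load : program :=
  Seq (mvpt SU SY) (Seq (Push SA (fun _ _ => Sp)) (mvall SY SA)).

Definition loads : program := While (on_top is_dg SU) load.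

Definition init : program :=
  Seq seps (Seq (mvall SB SU) (Seq (mvconf SU SB)
  (Seq loads (Seq (Pop _ _ SU) (mvall SB SU))))).

Lemma sepsP r w A b :
  exec seps r (mk w (e_items A) b [::] [::] [::]) (4 * size w + 1) r
    (mk [::] (e_items (nseq (size w) None ++ A)) (rev w ++ b) [::] [::] [::]).
Proof.
elim: w A b => [|x w IHw] A b; first exact: ExWhileF.
have h1 := ExPush SA (fun _ _ => Gp) r (mk (x :: w) (e_items A) b [::] [::] [::]).
rewrite updE in h1.
mk_step h2 (@mvP x SU SB r (mk (x :: w) (e_items (None :: A)) b [::] [::] [::]) _ isT erefl).
have h3 := IHw (None :: A) (x :: b).
apply: exec_conv (ExWhileT _ (ExSeq h1 h2) h3) _ _ => //; first by rewrite /=; lia.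
congr mk; last by rewrite rev_cons cat_rcons.
by rewrite -[None :: A]/(nseq 1 None ++ A) catA cat_nseq /ncons -iterD addn1.
Qed.

Definition unowned (t : point) : item := Some (t, None).

Lemma loadsP r c w A b :
  exec loads r (mk (e_pts c ++ Sp :: w) (e_items A) b [::] [::] [::])
    (9 * size (e_pts c) + 1) r
    (mk (Sp :: w) (e_items (rev (map unowned c) ++ A)) b [::] [::] [::]).
Proof.
elim: c A => [|t c IHc] A; first by apply: ExWhileF.
rewrite e_pts_cons -catA.
mk_step h1 (@mvptP SU SY t r (mk (e_pt t ++ e_pts c ++ Sp :: w) (e_items A) b [::] [::] [::]) _ isT erefl).
rewrite /= cats0 in h1.
have h2 := ExPush SA (fun _ _ => Sp) r (mk (e_pts c ++ Sp :: w) (e_items A) b [::] (rev (e_pt t)) [::]).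
rewrite updE in h2.
mk_step h3 (@mvallP SY SA r (mk (e_pts c ++ Sp :: w) (Sp :: e_items A) b [::] (rev (e_pt t)) [::]) isT).
rewrite revK in h3.
have h4 := IHc (unowned t :: A).
rewrite e_items_cons e_item_some e_conf_nil -catA in h4.
have [sg [u e]] := e_pt_head t.
apply: exec_conv (ExWhileT _ (ExSeq h1 (ExSeq h2 h3)) h4) _ _ => //.
- by rewrite e.
- by rewrite size_rev size_cat e /=; lia.
- by rewrite /= rev_cons cat_rcons.
Qed.

(** All separators stand behind the targets, so every price starts at 0. *)
Definition start_items (Cs Ct : seq point) : seq item :=
  rev (map unowned Ct) ++ nseq (size (e_conf Cs ++ e_conf Ct)) None.

Lemma initP r Cs Ct :
  exec init r (mk (e_conf Cs ++ e_conf Ct) [::] [::] [::] [::] [::])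
    (30 * size (e_conf Cs ++ e_conf Ct)) r
    (home Cs (start_items Cs Ct)).
Proof.
set w := e_conf Cs ++ e_conf Ct.
have h1 := sepsP r w [::] [::]; rewrite !cats0 in h1.
mk_step h2 (@mvallP SB SU r (mk [::] (e_items (nseq (size w) None)) (rev w) [::] [::] [::]) isT).
rewrite cats0 revK in h2.
mk_step h3 (@mvconfP SU SB Cs r (mk w (e_items (nseq (size w) None)) [::] [::] [::] [::]) (e_conf Ct) isT erefl).
rewrite /= cats0 (e_confE Ct) in h3.
have h4 := loadsP r Ct [::] (nseq (size w) None) (rev (e_conf Cs)).
have h5 := ExPop SU r (mk [:: Sp] (e_items (start_items Cs Ct)) (rev (e_conf Cs)) [::] [::] [::]).
rewrite updE in h5.
mk_step h6 (@mvallP SB SU r (mk [::] (e_items (start_items Cs Ct)) (rev (e_conf Cs)) [::] [::] [::]) isT).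
rewrite revK /= cats0 in h6.
apply: exec_conv (ExSeq h1 (ExSeq h2 (ExSeq h3 (ExSeq h4 (ExSeq h5 h6))))) _ erefl.
rewrite !size_rev /w !e_confE !size_cat /=; lia.
Qed.

Lemma size_e_items_start Cs Ct :
  size (e_items (start_items Cs Ct)) <= 3 * size (e_conf Cs ++ e_conf Ct).
Proof.
rewrite /start_items e_items_cat size_cat.
have -> : size (e_items (nseq (size (e_conf Cs ++ e_conf Ct)) None)) = size (e_conf Cs ++ e_conf Ct).
  by elim: (size (e_conf Cs ++ e_conf Ct)) => // k IHk; exact: (congr1 S IHk).
suff h : size (e_items (rev (map unowned Ct))) <= 2 * size (e_pts Ct).
  by rewrite size_cat (e_confE Ct) size_cat; lia.
elim: Ct => //= t c IHc.
rewrite rev_cons -cats1 e_items_cat e_items_cons e_item_some e_pts_cons !size_cat.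
have [sg [u e]] := e_pt_head t.
by rewrite e_conf_nil e ?size_cat /=; lia.
Qed.

Lemma nsep_start Cs Ct :
  nsep (start_items Cs Ct) = size (e_conf Cs ++ e_conf Ct).
Proof.
rewrite /nsep count_cat count_nseq mul1n count_rev.
by have -> : count is_sep (map unowned Ct) = 0 by elim: Ct.
Qed.

Lemma auction_inv_start Cs Ct :
  auction_inv Cs Ct Cs (recs 0 (start_items Cs Ct)).
Proof.
have -> : recs 0 (start_items Cs Ct) = [seq (0, (t, None)) | t <- rev Ct].
  have e0 k n : recs k (nseq n None) = [::] by elim: n k => //= n IHn k.
  rewrite /start_items recs_cat e0 cats0 -map_rev.
  by elim: (rev Ct) => //= t c ->.
split.
- by rewrite -map_comp map_id perm_rev.
- by have -> : pmap owner [seq (0, (t, None)) | t <- rev Ct] = [::] by elim: (rev Ct).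
- by move=> _ /mapP [t _ ->].
- by move=> _ /mapP [t _ ->].
- by move=> x y /mapP [t _ ->].
Qed.

(** * The whole algorithm and its running time *)

Definition reg_with (ok : bool) : reg := (tri_init ord0, (false, false), ok).

(** The final assignment resets all of the register but the verdict, because acceptance is a single
    state. *)
Definition matching : program :=
  Seq init (Seq main (Assign (fun r _ => reg_with r.2))).

Lemma size_pts Ct : size Ct <= size (e_conf Ct).
Proof.
elim: Ct => // t c IHc; have [sg [u e]] := e_pt_head t.
by rewrite e_conf_cons size_cat e /= addSn ltnS; apply: leq_trans IHc (leq_addl _ _).
Qed.

Lemma matching_exec : exists K, forall Cs Ct,
  uniq Cs -> uniq Ct -> size Cs = size Ct ->
  exists (ok : bool) m, (ok <-> transformation Cs Ct) /\
    exec matching (reg_with true) (input_mem SU emb (enc_input Cs Ct))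
      (K * (size (enc_input Cs Ct)).+1 ^ 4) (reg_with ok) m.
Proof.
(* A round costs at most [100 * (4 * n + 1) ^ 2 <= 1600 * (n + 1) ^ 2], and there are at most
   [n * n + 1] rounds; 2000 leaves room for the rest. *)
exists 2000 => Cs Ct uCs uCt eqs.
set n := size (enc_input Cs Ct).
have en : size (e_conf Cs ++ e_conf Ct) = n by rewrite /n -map_cat size_map.
have em : input_mem SU emb (enc_input Cs Ct) = mk (e_conf Cs ++ e_conf Ct) [::] [::] [::] [::] [::].
  by rewrite /input_mem /enc_input map_cat; apply: functional_extensionality; case.
have hCt : size Ct <= n.
  by rewrite -en size_cat; apply: leq_trans (size_pts Ct) (leq_addl _ _).
have h1 := initP (reg_with true) Cs Ct.
have [||||r' [m [hok h2]]] := @mainP Cs Ct uCs uCt eqs n (size Ct * n) Cs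
  (start_items Cs Ct) (reg_with true) hCt.
- by rewrite nsep_start.
- exact: auction_inv_start.
- by [].
- exact: leq_addl.
exists r'.2, m; split=> //; rewrite em.
have h3 : exec (Assign (fun r _ => reg_with r.2)) r' m 1 (reg_with r'.2) m := ExAssign _ _ _.
apply: exec_conv (ExSeq h1 (ExSeq h2 h3)) _ erefl.
rewrite en.
have hz : home_size Cs (start_items Cs Ct) <= 4 * n.
  rewrite /home_size; have := size_e_items_start Cs Ct; rewrite en.
  by move: en; rewrite size_cat; lia.
have hr := round_cost_mono hz.
have hd : size Ct * n <= n * n by rewrite leq_mul2r hCt orbT.
apply: (@leq_trans (30 * n + ((n * n).+1 * (round_cost (4 * n)).+1 + 1 + 1))).
  by rewrite leq_add2l !leq_add2r leq_mul.
rewrite /round_cost; nia.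
Qed.

(** The simulation about squares the quartic running time, hence degree 8; [n.+1 <= 2 * n] gives the
    factor [2 ^ 8]. *)
Lemma poly_bound K n : 0 < n ->
  (K * n.+1 ^ 4) * ((n + K * n.+1 ^ 4).*2 + 3) <=
  (5 * K.+1 ^ 2 * 2 ^ 8) * n ^ 8 + (5 * K.+1 ^ 2 * 2 ^ 8).
Proof.
move=> hn; apply: leq_trans (leq_addr _ _).
have -> : 5 * K.+1 ^ 2 * 2 ^ 8 * n ^ 8 = 5 * K.+1 ^ 2 * (2 * n) ^ 8 by rewrite expnMn mulnA.
have h4 : n.+1 <= n.+1 ^ 4 by rewrite -{1}[n.+1]expn1 leq_exp2l.
apply: (@leq_trans (5 * K.+1 ^ 2 * n.+1 ^ 8)); last first.
  by rewrite leq_mul2l leq_exp2r // orbC; apply/orP; left; lia.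
have -> : n.+1 ^ 8 = n.+1 ^ 4 * n.+1 ^ 4 by rewrite -expnD.
move: (n.+1 ^ 4) h4 => M hM.
apply: (@leq_trans (K.+1 * M * (5 * (K.+1 * M)))); last by rewrite expnS expn1; nia.
by apply: leq_mul; [rewrite leq_mul2r leqnSn orbT | nia].
Qed.

(* There is a polynomial-time (deterministic single-tape Turing machine)
   algorithm which, given two configurations Cs, Ct of n grid vertices each
   (binary encoded), decides whether a makespan-1 schedule transforms Cs
   into Ct. *)
Theorem theorem1 :
  exists (M : TM) (c k : nat),
    forall (Cs Ct : seq point),
      uniq Cs -> uniq Ct -> size Cs = size Ct ->
      decides_within M (enc_input Cs Ct)
        (c * (size (enc_input Cs Ct)) ^ k + c)
        (schedule_makespan1 Cs Ct).
Proof.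
have [K hK] := matching_exec.
exists (machine SU emb (reg_with true) matching (reg_with true)).
exists (5 * K.+1 ^ 2 * 2 ^ 8), 8 => Cs Ct uCs uCt eqs.
have [ok [m [hok hm]]] := hK Cs Ct uCs uCt eqs.
have [t [ht [hh ha]]] := exec_decides (reg_with true) hm.
exists t; split.
  apply: leq_trans ht (poly_bound _ _).
  (* The closing separators make every input nonempty. *)
  by rewrite /enc_input /enc_config !size_cat /=; lia.
split=> //.
by split=> [/ha [e]|/hok e]; [apply/hok; rewrite e | apply/ha; rewrite e].
Qed.
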